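(* Let $T$ be a sublinear operator acting on measurable functions on $\mathbb{R}^n$. Suppose that $T:L^1\to L^{1,\infty}$ is bounded and that there exist $p_0>1$, a constant $C>0$ and an admissible function $\varphi$ such that, for every $u\in A_{p_0}$, $T:L^{p_0,1}(u)\to L^{p_0,\infty}(u)$ is bounded with constant $C\varphi(\|u\|_{A_{p_0}})$. Then there is a constant $C'>0$ such that, for every $t>0$ and every measurable function $f$, $$(Tf)^*(t)\le C'\left(\frac1t\int_0^t f^*(s)\,ds+\int_t^\infty\left(1+\log\frac st\right)^{-1}\varphi\left(1+\log\frac st\right)f^*(s)\,\frac{ds}{s}\right).$$
   Context: A function $\varphi:[1,\infty]\to[1,\infty]$ is called admissible if: (a) $\varphi(1)=1$ and $\varphi$ is log-concave, i.e. $\theta\log\varphi(x)+(1-\theta)\log\varphi(y)\le\log\varphi(\theta x+(1-\theta)y)$ for all $x,y\ge1$ and $0\le\theta\le1$; and (b) there exist $\gamma,\beta>0$ such that $\frac{\gamma}{x}\le\frac{\varphi'(x)}{\varphi(x)}\le\frac{\beta}{x}$ for every $x\ge1$. For $1<p<\infty$, $A_p$ is the Muckenhoupt class of weights $u$ on $\mathbb{R}^n$ with $\|u\|_{A_p}=\sup_Q\left(\frac1{|Q|}\int_Q u\right)\left(\frac1{|Q|}\int_Q u^{-1/(p-1)}\right)^{p-1}<\infty$, the supremum being over all cubes $Q$. $L^{p,1}(u)$ and $L^{p,\infty}(u)$ are the Lorentz spaces for the measure $u(x)\,dx$: $\|f\|_{L^{p,1}(u)}=\int_0^\infty u(\{|f|>y\})^{1/p}\,dy$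 and $\|f\|_{L^{p,\infty}(u)}=\sup_{y>0}y\,u(\{|f|>y\})^{1/p}$; $L^1$ and $L^{1,\infty}$ without a weight refer to Lebesgue measure. The decreasing rearrangement with respect to Lebesgue measure is $f^*(t)=\inf\{s>0:|\{|f|>s\}|\le t\}$.
   Formalization: The bound is proved for every measurable f at which |Tf| ≤ Σ_k |T(f·1_{A_k})| a.e. for all countable measurable partitions (A_k); with only finite sublinearity the claim fails for f outside the span of L^1 and the spaces L^{p_0,1}(u). *)

(* Defs.v *)
From HB Require Import structures.
From mathcomp Require Import all_boot all_order all_algebra.
From mathcomp Require Import all_classical all_reals all_analysis.
From mathcomp Require Import measurable_realfun.
Set Implicit Arguments.
Unset Strict Implicit.
Unset Printing Implicit Defensive.
Import Order.TTheory GRing.Theory Num.Theory.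
Import numFieldNormedType.Exports.
Local Open Scope classical_set_scope.
Local Open Scope ring_scope.

Notation Rn R n := (n.-tuple (measurableTypeR R)).

Section lebesgue_measure_Rn.
Context {R : realType}.
Local Open Scope ereal_scope.

Definition tcons {n} (p : measurableTypeR R * Rn R n) : Rn R n.+1 :=
  [tuple of p.1 :: p.2].

Lemma measurable_tcons {n} : measurable_fun setT (@tcons n).
Proof. exact: measurable_cons. Qed.

Section cons_measure.
Variables (n : nat) (mu : {sigma_finite_measure set (Rn R n) -> \bar R}).

Definition cons_measure : set (Rn R n.+1) -> \bar R :=
  pushforward (lebesgue_measure \x mu) tcons.

Let cons_measure0 : cons_measure set0 = 0.
Proof. by rewrite /cons_measure /pushforward preimage_set0 measure0. Qed.

Let cons_measure_ge0 A : 0 <= cons_measure A.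
Proof. by rewrite /cons_measure /pushforward measure_ge0. Qed.

Let cons_measure_sigma_additive : semi_sigma_additive cons_measure.
Proof.
have mt A : measurable A -> measurable (@tcons n @^-1` A).
  by move=> mA; rewrite -[X in measurable X]setTI; exact: measurable_tcons.
move=> F mF tF mUF; rewrite /cons_measure /pushforward preimage_bigcup.
apply: measure_semi_sigma_additive.
- by move=> k; exact: mt.
- apply/trivIsetP => /= i j _ _ ij; rewrite -preimage_setI.
  by move/trivIsetP : tF => /(_ _ _ _ _ ij) ->//; rewrite preimage_set0.
- by rewrite -preimage_bigcup; exact: mt.
Qed.

HB.instance Definition _ := isMeasure.Build _ _ _ cons_measure
  cons_measure0 cons_measure_ge0 cons_measure_sigma_additive.

Let cons_measure_sigma_finite : sigma_finite setT cons_measure.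
Proof.
have /sigma_finiteP[F [TF ndF Foo]] := sigma_finiteT (@lebesgue_measure R).
have /sigma_finiteP[G [TG ndG Goo]] := sigma_finiteT mu.
pose unc (t : Rn R n.+1) : measurableTypeR R * Rn R n :=
  (thead t, [tuple of behead t]).
have munc : measurable_fun setT unc.
  apply/measurable_fun_pairP; split; first exact: measurable_tnth.
  exact: measurable_behead.
have consK p : unc (tcons p) = p.
  by case: p => x y; rewrite /unc /tcons theadE; congr pair; exact/val_inj.
exists (fun k => unc @^-1` (F k `*` G k)).
  apply/esym; rewrite -subTset => t _.
  have [k _ Fk] : (\bigcup_i F i) (unc t).1 by rewrite -TF.
  have [l _ Gl] : (\bigcup_i G i) (unc t).2 by rewrite -TG.
  exists (maxn k l) => //; split.
    by move: Fk; exact/subsetPset/ndF/leq_maxl.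
  by move: Gl; exact/subsetPset/ndG/leq_maxr.
move=> k; have [mF Fk] := Foo k; have [mG Gk] := Goo k; split.
  rewrite -[X in measurable X]setTI; apply: munc => //.
  exact: measurableX.
rewrite /cons_measure /pushforward.
rewrite (_ : _ @^-1` _ = F k `*` G k); last first.
  by apply/funext => p; exact: (congr1 (F k `*` G k) (consK p)).
by rewrite product_measure1E// lte_mul_pinfty// ge0_fin_numE.
Qed.

HB.instance Definition _ := Measure_isSigmaFinite.Build _ _ _ cons_measure
  cons_measure_sigma_finite.

End cons_measure.

(* Lebesgue measure on R^n, as the n-fold product of the measure of R *)
Fixpoint lebesgue_measure_Rn n : {sigma_finite_measure set (Rn R n) -> \bar R} :=
  match n with
  | 0 => \d_([tuple] : Rn R 0)
  | m.+1 => cons_measure (lebesgue_measure_Rn m)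
  end.

Lemma lebesgue_measure_Rn_box n (A : 'I_n -> set (measurableTypeR R)) :
  (forall i, measurable (A i)) ->
  lebesgue_measure_Rn n [set x | forall i, A i (tnth x i)] =
  \prod_(i < n) lebesgue_measure (A i).
Proof.
elim: n A => [|n IH] A mA.
  by rewrite big_ord0 /= diracE mem_set// => -[].
rewrite big_ord_recl /= /cons_measure /pushforward -IH//.
rewrite -product_measure1E//; last first.
  rewrite (_ : mkset _ = \bigcap_(i in [set: 'I_n])
      ((fun t : Rn R n => tnth t i) @^-1` A (lift ord0 i))).
    apply: fin_bigcap_measurable => // i _.
    by rewrite -[X in measurable X]setTI; exact: measurable_tnth.
  by apply/seteqP; split => [t /= h i _|t h i]; [exact: h|exact: (h i)].
congr (_ _); apply/seteqP; split => -[x y] /=.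
  move=> h; split; first by have := h ord0; rewrite /tcons tnth0.
  by move=> i; have := h (lift ord0 i); rewrite /tcons tnthS.
move=> [hx hy] i; case: (unliftP ord0 i) => [j ->|->].
  by rewrite /tcons tnthS; exact: hy.
by rewrite /tcons tnth0.
Qed.

End lebesgue_measure_Rn.

Definition cubes {R : realType} n : set (set (Rn R n)) :=
  [set Q | exists (a : 'I_n -> R) (l : R), 0 < l /\
    Q = [set x | forall i, a i <= tnth x i <= a i + l]].

Section weights.
Context {R : realType} {n : nat}.
Local Open Scope ereal_scope.
Implicit Types (u f : Rn R n -> R) (Q A : set (Rn R n)).

Local Notation mu := (lebesgue_measure_Rn n).

Definition average Q f : \bar R :=
  ((fine (mu Q))^-1)%:E * \int[mu]_(x in Q) (f x)%:E.

Definition Ap_norm (p : R) u : \bar R :=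
  ereal_sup [set average Q u *
      (average Q (fun x => (u x `^ (- (p - 1)^-1))%R)) `^ (p - 1) | Q in @cubes R n].

(* The a.e. positivity is part of the notion of weight; it also keeps the value
   [0 `^ r = 0] taken by [powR] at negative r out of [Ap_norm].
   Local integrability follows from [Ap_norm p u < +oo]. *)
Definition weight u : Prop :=
  [/\ measurable_fun [set: Rn R n] u,
      forall x, (0 <= u x)%R &
      {ae mu, forall x, (0 < u x)%R}].

Definition Ap (p : R) : set (Rn R n -> R) :=
  [set u | weight u /\ Ap_norm p u < +oo].

Definition wmeasure u A : \bar R := \int[mu]_(x in A) (u x)%:E.

End weights.

Section lorentz.
Context {R : realType} {n : nat}.
Local Open Scope ereal_scope.
Implicit Types (nu : set (Rn R n) -> \bar R) (f : Rn R n -> \bar R).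

Definition distribution_function nu f (y : R) : \bar R :=
  nu [set x | y%:E < `|f x|].

Definition lorentz_p1 nu (p : R) f : \bar R :=
  \int[lebesgue_measure]_(y in `]0%R, +oo[)
    (distribution_function nu f y) `^ p^-1.

Definition lorentz_pinfty nu (p : R) f : \bar R :=
  ereal_sup [set y%:E * (distribution_function nu f y) `^ p^-1 |
             y in [set y : R | (0 < y)%R]].

Definition rearrangement f (t : R) : \bar R :=
  ereal_inf [set s%:E | s in [set s : R | (0 < s)%R /\
    distribution_function (lebesgue_measure_Rn n) f s <= t%:E]].

End lorentz.

(* phi is only constrained on [1, +oo[; its derivative is taken along that
   half-line, hence is the right derivative at 1. *)
Definition admissible {R : realType} (phi : R -> R) : Prop :=
  [/\ forall x, 1 <= x -> 1 <= phi x,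
      phi 1 = 1,
      forall x y theta : R, 1 <= x -> 1 <= y -> 0 <= theta <= 1 ->
        theta * ln (phi x) + (1 - theta) * ln (phi y) <=
        ln (phi (theta * x + (1 - theta) * y)) &
      exists gamma beta : R, [/\ 0 < gamma, 0 < beta &
        forall x, 1 <= x -> exists dphi : R,
          (phi y - phi x) / (y - x) @[y --> within [set y | 1 <= y] x^'] --> dphi
          /\ gamma / x <= dphi / phi x <= beta / x]].

Section operators.
Context {R : realType} {n : nat}.
Local Open Scope ereal_scope.
Implicit Types (T : (Rn R n -> R) -> Rn R n -> \bar R) (f g : Rn R n -> R).

Local Notation mu := (lebesgue_measure_Rn n).

(* Values of T f are extended reals, so that maximal operators are covered, as
   are operators given on a linear space of functions only (put T f = +oo
   outside of it). *)
Definition sublinear T : Prop :=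
  [/\ forall f, measurable_fun [set: Rn R n] f ->
        measurable_fun [set: Rn R n] (T f),
      forall f g, measurable_fun [set: Rn R n] f ->
        measurable_fun [set: Rn R n] g ->
        {ae mu, forall x, `|T (f \+ g)%R x| <= `|T f x| + `|T g x|} &
      forall (c : R) f, measurable_fun [set: Rn R n] f ->
        {ae mu, forall x, `|T (fun z => c * f z)%R x| = `|c|%:E * `|T f x|}].

(* Finite sublinearity and boundedness from L^1 to L^{1,oo} and from L^{p,1}(u)
   to L^{p,oo}(u) say nothing about T f for f outside of the linear span D of
   these domains: T f := +oo outside of D and T f := 0 on D satisfies them all.
   The condition below excludes this. It holds at every f if T is
   sigma-sublinear. It also holds, without any further assumption on T, at every
   f in D, because T is then small on the tails f * \1_(\bigcup_(k >= N) A k). *)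
Definition countably_subadditive_at T f : Prop :=
  forall A : nat -> set (Rn R n), (forall k, measurable (A k)) ->
    trivIset [set: nat] A -> \bigcup_k A k = [set: Rn R n] ->
    {ae mu, forall x, `|T f x| <= \sum_(0 <= k <oo) `|T (f \* \1_(A k))%R x|}.

End operators.

(* Main.v *)
Require Import Defs.
From HB Require Import structures.
From mathcomp Require Import all_boot all_order all_algebra.
From mathcomp Require Import all_classical all_reals all_analysis.
From mathcomp Require Import measurable_realfun.
From mathcomp Require Import ring lra.
Set Implicit Arguments.
Unset Strict Implicit.
Unset Printing Implicit Defensive.
Import Order.TTheory GRing.Theory Num.Theory.
Import numFieldNormedType.Exports.
Local Open Scope classical_set_scope.
Local Open Scope ring_scope.
Local Open Scope ereal_scope.

(* Let [F] be a subset of [{|T g| > y}] with [tau < |F|], where [|g| <= a] is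
   supported on [E] and [|E| <= 2^N tau].
   The weight [u = 1_F + max (M 1_F, 2^-N) / N] is in A_1, hence in A_p0, with
   constant O(N), while [u(F) >= |F|] and, because [{M 1_F > 2^-k}] has measure
   O(2^k |F|), [u(E) = O(|F|)]. The weighted bound then gives [y = O(phi(N) a)],
   with no loss of a power of N. For general f, cut at the values of [f*] at the
   points [s_j = t exp(2^j - 1)], where [1 + log (s/t)] doubles: the top part is
   handled by the weak type (1,1) bound, the j-th layer contributes
   [O(phi(2^j) f*(s_j))] outside a set of measure [t 2^(-j-2)] (the smallness of
   that set costs only a factor in N), and the sum of these contributions is
   comparable to the logarithmic integral. *)

(** The bound sees the weight only through its A_p constant, so the aim is a weight giving mass at
    least |F| to F and O(|F|) to E, with an A_p constant only logarithmic in |E|/|F|. The maximal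
    function is not strongly bounded on L^1: each dyadic level of M 1_F between 1 and 2^-N may carry
    mass of order |F| on E, hence N |F| in total. Dividing by N repairs the mass; since averages of
    1_F are controlled by M 1_F and no longer by M 1_F / N, the A_1 constant becomes O(N). Levels
    below 2^-N are replaced by a constant floor, harmless because 2^-N |E| <= |F|.

    The doubling of 1 + log (s/t) serves twice. On a layer N is comparable with 1 + log (s/t), and
    the upper bound on phi'/phi makes phi (K x) comparable with phi x, so constants inside phi are
    harmless. Moreover the layer has logarithmic length 2^j, which cancels the factor (1 + log
    (s/t))^-1: each layer of the integral yields one term phi(2^j) f*(s_(j+1)), without that
    factor. *)

Section cubes.
Context {R : realType} {n : nat}.
Local Notation mu := (lebesgue_measure_Rn n).
Implicit Types (a : 'I_n -> R) (l : R) (F : set (Rn R n)).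

(** * Cubes and a Vitali covering bound *)

Definition cube a l : set (Rn R n) :=
  [set x | forall i, (a i <= tnth x i <= a i + l)%R].

Lemma measurable_cube a l : measurable (cube a l).
Proof.
rewrite (_ : cube a l = \bigcap_(i in [set: 'I_n])
    ((fun x : Rn R n => tnth x i) @^-1` `[a i, (a i + l)%R])).
  apply: fin_bigcap_measurable => // i _.
  by rewrite -[X in measurable X]setTI; exact: measurable_tnth.
by apply/seteqP; split => [x /= h i _|x h i];
  [rewrite /= in_itv /=; exact: h|have := h i I; rewrite /= in_itv].
Qed.
Hint Resolve measurable_cube : core.

Lemma measure_cube a l : (0 <= l)%R -> mu (cube a l) = (l ^+ n)%:E.
Proof.
move=> l0; have := @lebesgue_measure_Rn_box R n (fun i => `[a i, (a i + l)%R]%classic).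
rewrite (_ : [set x | _] = cube a l); last first.
  by apply/seteqP; split => x /= h i; have := h i; rewrite in_itv.
move=> -> //; rewrite (eq_bigr (fun=> l%:E)); last first.
  move=> i _; rewrite lebesgue_measure_itv /= lte_fin.
  case: ltP => [_|]; first by rewrite -EFinD addrAC subrr add0r.
  by rewrite gerDl => l0'; congr EFin; apply/eqP; rewrite eq_le l0 l0'.
by rewrite prodEFin prodr_const card_ord.
Qed.

Lemma cube_tripled a b l r : (r <= l)%R -> cube a l `&` cube b r !=set0 ->
  cube b r `<=` cube (fun i => a i - l)%R (3 * l)%R.
Proof.
move=> rl [z [za zb]] x xb i; have := za i; have := zb i; have := xb i.
by move=> /andP[? ?] /andP[? ?] /andP[? ?]; apply/andP; split; lra.
Qed.

Lemma exists_maxr (l : nat -> R) (s : seq nat) : s != [::] ->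
  exists2 i, i \in s & forall j, j \in s -> (l j <= l i)%R.
Proof.
elim: s => // k s IH _; have [->|/IH[i si iP]] := eqVneq s [::].
  by exists k; rewrite ?inE// => j; rewrite inE => /eqP ->.
have [ki|ik] := leP (l k) (l i).
  by exists i; rewrite ?inE ?si ?orbT// => j; rewrite inE => /predU1P[->//|/iP].
exists k; rewrite ?inE ?eqxx// => j; rewrite inE => /predU1P[->//|/iP/le_trans].
by apply; exact: ltW.
Qed.

(** Greedy choice of a largest cube [Q0]: the cubes meeting it lie in its triple, and the others
    avoid it, so they keep their density when [F] is replaced by [F] minus [Q0]. Splitting [F] in
    this way replaces the extraction of a disjoint subfamily. *)
Lemma vitali_finite (a : nat -> 'I_n -> R) (l : nat -> R) (L : R) F (s : seq nat) :
  (0 <= L)%R -> measurable F ->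
  (forall i, i \in s -> (0 <= l i)%R) ->
  (forall i, i \in s -> mu (cube (a i) (l i)) <= L%:E * mu (F `&` cube (a i) (l i))) ->
  mu (\bigcup_(i in [set` s]) cube (a i) (l i)) <= (3 ^+ n * L)%:E * mu F.
Proof.
move=> L0; have [m] := ubnP (size s); elim: m s F => // m IH s F sm mF l0 lP.
have [->|s0] := eqVneq s [::].
  by rewrite bigcup0// measure0 mule_ge0// lee_fin mulr_ge0// exprn_ge0.
have [i0 si0 i0P] := exists_maxr l s0.
pose Q0 := cube (a i0) (l i0).
pose s' := [seq i <- s | `[< cube (a i) (l i) `&` Q0 = set0 >]].
have s's i : i \in s' -> i \in s by rewrite mem_filter => /andP[].
have mU (s1 : seq nat) : measurable (\bigcup_(i in [set` s1]) cube (a i) (l i)).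
  by apply: bigcup_measurable.
(* If [i0] survived the filter, [Q0] would be disjoint from itself, yet it contains its lower
   corner. Hence [s'] is shorter than [s]. *)
have [i0s'|i0s'] := boolP (i0 \in s').
  move: i0s'; rewrite mem_filter => /andP[/asboolP + _]; rewrite /Q0 setIid => Q00.
  have [x xQ] : Q0 !=set0.
    exists [tuple a i0 i | i < n] => i; rewrite tnth_mktuple lexx /= lerDl.
    exact: l0.
  by exfalso; move: xQ; rewrite /Q0 Q00.
have /(IH s' (F `\` Q0)) : (size s' < m)%N.
  rewrite -ltnS; apply: leq_ltn_trans sm; rewrite size_filter.
  rewrite ltn_neqAle count_size andbT -all_count; apply/negP => /allP/(_ _ si0) h.
  by move/negP: i0s'; apply; rewrite mem_filter h.
move=> /(_ (measurableD mF (measurable_cube _ _)) (fun i h => l0 i (s's i h))).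
move=> /(_ _)/wrap[i|].
  move=> is'; apply: le_trans (lP i (s's i is')) _; rewrite le_eqVlt; apply/orP; left.
  apply/eqP; congr (_ * mu _); apply/seteqP; split => x [Fx xi]; split=> //; last by case: Fx.
  split=> // Q0x; move: is'; rewrite mem_filter => /andP[/asboolP E _].
  by have : set0 x by rewrite -E.
move=> s'F.
have le1 : mu (cube (fun i => a i0 i - l i0)%R (3 * l i0)%R) <=
    (3 ^+ n * L)%:E * mu (F `&` Q0).
  rewrite measure_cube ?mulr_ge0 ?l0// exprMn EFinM EFinM -muleA lee_pmul2l ?lte_fin ?exprn_gt0//.
  by rewrite -(measure_cube (a i0)) ?l0// lP.
rewrite (measureDI _ mF (measurable_cube (a i0) (l i0))) ge0_muleDr//.
apply: le_trans (leeD s'F le1).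
apply: le_trans (measureU2 _ _ _) => //.
apply: le_measure; rewrite ?inE //; first by apply: measurableU.
move=> x [i /= si xi]; have [is'|is'] := boolP (i \in s'); first by left; exists i.
right; move: is'; rewrite mem_filter si andbT => /asboolP/eqP/set0P QQ0.
by apply: (cube_tripled _ _ xi) => //; [exact: i0P|rewrite setIC].
Qed.

Lemma vitali_countable (P : set nat) (a : nat -> 'I_n -> R) (l : nat -> R) (L : R) F :
  (0 <= L)%R -> measurable F ->
  (forall i, P i -> (0 <= l i)%R) ->
  (forall i, P i -> mu (cube (a i) (l i)) <= L%:E * mu (F `&` cube (a i) (l i))) ->
  mu (\bigcup_(i in P) cube (a i) (l i)) <= (3 ^+ n * L)%:E * mu F.
Proof.
move=> L0 mF l0 lP.
pose s m := [seq i <- iota 0 m | `[< P i >]].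
have sP m i : i \in s m -> P i by rewrite mem_filter => /andP[/asboolP].
pose G m := \bigcup_(i in [set` s m]) cube (a i) (l i).
have -> : \bigcup_(i in P) cube (a i) (l i) = \bigcup_m G m.
  apply/seteqP; split => [x [i Pi xi]|x [m _ [i /sP Pi xi]]]; last by exists i.
  exists i.+1 => //; exists i => //=; rewrite mem_filter mem_iota /= add0n ltnS leqnn.
  by rewrite andbT; exact/asboolP.
have mG m : measurable (G m) by exact: bigcup_measurable.
have cvG : mu \o G @ \oo --> mu (\bigcup_m G m).
  apply: nondecreasing_cvg_mu => //; first exact: bigcup_measurable.
  move=> m1 m2 m12; apply/subsetPset => x [i /=]; rewrite mem_filter => /andP[Pi im] xi.
  exists i => //=; rewrite mem_filter Pi /=; move: im; rewrite !mem_iota /= !add0n.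
  by move=> /leq_trans; apply.
rewrite -(cvg_lim _ cvG)//; apply: lime_le; first by apply/cvg_ex; eexists; exact: cvG.
apply: nearW => m /=; apply: vitali_finite => // i /sP; [exact: l0|exact: lP].
Qed.

End cubes.
#[global] Hint Extern 0 (measurable (cube _ _)) => solve [exact: measurable_cube] : core.

(** * Maximal sets over a countable family of cubes *)

Section rational_cubes.
Context {R : realType} {n : nat}.
Local Notation mu := (lebesgue_measure_Rn n).
Implicit Types (a : 'I_n -> R) (l h : R) (F : set (Rn R n)) (i : nat).

(* Enumeration of the cubes with rational corner and side; sides may be <= 0. *)
Definition rat_corner i : 'I_n -> R :=
  if (unpickle i : option ({ffun 'I_n -> rat} * rat)%type) is Some c
  then fun j => ratr (c.1 j) else fun=> 0%R.
Definition rat_side i : R :=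
  if (unpickle i : option ({ffun 'I_n -> rat} * rat)%type) is Some c
  then ratr c.2 else 0%R.
Definition rat_cube i := cube (rat_corner i) (rat_side i).

Lemma measurable_rat_cube i : measurable (rat_cube i).
Proof. exact: measurable_cube. Qed.
Hint Resolve measurable_rat_cube : core.

Lemma measure_rat_cube i : (0 <= rat_side i)%R -> mu (rat_cube i) = (rat_side i ^+ n)%:E.
Proof. exact: measure_cube. Qed.

Lemma rat_cubeP (b : 'I_n -> rat) (r : rat) :
  exists i, rat_corner i = (fun j => ratr (b j)) /\ rat_side i = ratr r.
Proof.
exists (pickle ([ffun j => b j], r)); rewrite /rat_corner /rat_side pickleK /=.
by split=> //; apply/funext => j; rewrite ffunE.
Qed.

Lemma rat_cube_cover a l : (0 < l)%R ->
  exists i, [/\ (0 < rat_side i)%R, (rat_side i <= 2 * l)%R & cube a l `<=` rat_cube i].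
Proof.
move=> l0.
have h j : exists q : rat, (a j - l / 4 < ratr q < a j)%R.
  have [|q] := @rat_in_itvoo R (a j - l / 4)%R (a j); first by lra.
  by rewrite in_itv /= => qa; exists q.
have {h}[b bP] := choice h.
(* A side above [l + l / 4] compensates for corners lowered by less than [l / 4]. *)
have [|r] := @rat_in_itvoo R (l + l / 4)%R (l + l / 2)%R; first by lra.
rewrite in_itv /= => /andP[r1 r2].
have [i [ci si]] := rat_cubeP b r.
exists i; rewrite /rat_cube si ci; split; [lra|lra|].
move=> x xa j; have := xa j; have := bP j => /andP[? ?] /andP[? ?].
by apply/andP; split; lra.
Qed.

(** Closure of the enumeration under tripling lets the triple of a dense cube be tested again
    against the maximal sets. *)
Lemma rat_cube_tripled i : exists i',
  rat_corner i' = (fun j => rat_corner i j - rat_side i)%R /\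
  rat_side i' = (3 * rat_side i)%R.
Proof.
rewrite /rat_corner /rat_side.
case: (unpickle i) => [c|]; last first.
  have [i' [ci si]] := rat_cubeP (fun=> 0%R) 0%R; exists i'.
  rewrite -/(rat_corner i') -/(rat_side i') ci si rmorph0 mulr0; split=> //.
  by apply/funext => j; rewrite subr0.
have [i' [ci si]] := rat_cubeP (fun j => c.1 j - c.2)%R (3 * c.2)%R; exists i'.
rewrite -/(rat_corner i') -/(rat_side i') ci si rmorphM /= ratr_nat; split=> //.
by apply/funext => j; rewrite rmorphB.
Qed.

Definition dense_in F h : set nat :=
  [set i | (0 < rat_side i)%R /\ h%:E * mu (rat_cube i) < mu (F `&` rat_cube i)].

(* The superlevel set [{M 1_F > h}] of the maximal function over rational cubes. *)
Definition maximal_set F h : set (Rn R n) := \bigcup_(i in dense_in F h) rat_cube i.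

Lemma measurable_maximal_set F h : measurable (maximal_set F h).
Proof. by apply: bigcup_measurable. Qed.

Lemma measure_maximal_set F h : (0 < h)%R -> measurable F ->
  mu (maximal_set F h) <= (3 ^+ n * h^-1)%:E * mu F.
Proof.
move=> h0 mF; apply: vitali_countable => //; first by rewrite invr_ge0 ltW.
  by move=> i [/ltW].
by move=> i [si /ltW]; rewrite lee_pdivlMl.
Qed.

End rational_cubes.
#[global] Hint Extern 0 (measurable (rat_cube _)) =>
  solve [exact: measurable_rat_cube] : core.
#[global] Hint Extern 0 (measurable (maximal_set _ _)) =>
  solve [exact: measurable_maximal_set] : core.

(** * The weight attached to F and its mass *)

Section weight.
Context {R : realType} {n : nat}.
Local Notation mu := (lebesgue_measure_Rn n).
Variables (F : set (Rn R n)) (N : nat).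
Hypotheses (mF : measurable F) (N0 : (0 < N)%N).

Let pow2_gt0 k : (0 < 2 ^- k :> R)%R.
Proof. by rewrite invr_gt0 exprn_gt0. Qed.

(* Up to constants, [1_F + max (M 1_F, 2^-N) / N] *)
Definition level_weight (x : Rn R n) : R :=
  (\1_F x + N%:R^-1 *
     (2 ^- N + \sum_(k < N) 2 ^- k.+1 * \1_(maximal_set F (2 ^- k.+1)) x))%R.
Local Notation w := level_weight.

Let N0' : (0 < N%:R :> R)%R. Proof. by rewrite ltr0n. Qed.

Let sum_ge0 x : (0 <= \sum_(k < N) 2 ^- k.+1 * \1_(maximal_set F (2 ^- k.+1)) x :> R)%R.
Proof. by apply: sumr_ge0 => k _; rewrite mulr_ge0// ltW// pow2_gt0. Qed.

Lemma measurable_level_weight : measurable_fun setT w.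
Proof.
apply: measurable_funD; first exact: measurable_indic.
apply: measurable_funM => //; apply: measurable_funD => //.
by apply: measurable_sum => k; apply: measurable_funM => //; exact: measurable_indic.
Qed.

Lemma level_weight_ge (x : Rn R n) : (2 ^- N <= N%:R * w x)%R.
Proof.
rewrite /w mulrDr mulrA divff ?gt_eqF// mul1r -[leLHS]add0r lerD ?mulr_ge0//.
by rewrite lerDl.
Qed.

Lemma level_weight_gt0 (x : Rn R n) : (0 < w x)%R.
Proof.
by have := lt_le_trans (pow2_gt0 N) (level_weight_ge x); rewrite pmulr_rgt0.
Qed.

Lemma level_weight_ge1 (x : Rn R n) : F x -> (1 <= w x)%R.
Proof.
move=> Fx; rewrite /w indicE mem_set//= lerDl mulr_ge0 ?invr_ge0 ?ltW//.
by rewrite ltr_pwDl// pow2_gt0.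
Qed.

Lemma level_weight_maximal (x : Rn R n) k : (k < N)%N ->
  maximal_set F (2 ^- k.+1)%R x -> (2 ^- k.+1 <= N%:R * w x)%R.
Proof.
move=> kN xk; rewrite /w mulrDr mulrA divff ?gt_eqF// mul1r -[leLHS]add0r lerD ?mulr_ge0//.
rewrite (bigD1 (Ordinal kN))//= indicE mem_set// mulr1 addrCA lerDl addr_ge0//.
by apply: sumr_ge0 => j _; rewrite mulr_ge0// ltW// pow2_gt0.
Qed.

Lemma integral_level_weight A : measurable A ->
  \int[mu]_(x in A) (w x)%:E = mu (F `&` A) + (N%:R^-1)%:E *
   ((2 ^- N)%:E * mu A +
     \sum_(k < N) (2 ^- k.+1)%:E * mu (maximal_set F (2 ^- k.+1) `&` A)).
Proof.
move=> mA.
have m1 k : measurable_fun A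
    (fun x => ((2 ^- k.+1)%:E * (\1_(maximal_set F (2 ^- k.+1)) x)%:E : \bar R)).
  by apply: emeasurable_funM => //; apply/measurable_EFinP; exact: measurable_indic.
under eq_integral.
  move=> x _; rewrite /w EFinD EFinM EFinD -sumEFin.
  under eq_bigr do rewrite EFinM.
  over.
have p0 k : (0 <= 2 ^- k :> R)%R by rewrite ltW// pow2_gt0.
have s0 (x : Rn R n) : 0 <= \sum_(i < N) ((2 ^- i.+1)%:E * (\1_(maximal_set F (2 ^- i.+1)%R) x)%:E : \bar R).
  by apply: sume_ge0 => k _; rewrite -EFinM lee_fin mulr_ge0.
have msum : measurable_fun A (fun x : Rn R n =>
    (\sum_(i < N) ((2 ^- i.+1)%:E * (\1_(maximal_set F (2 ^- i.+1)%R) x)%:E : \bar R))).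
  exact: emeasurable_sum.
rewrite ge0_integralD//; first last.
- by apply: emeasurable_funM => //; exact: emeasurable_funD.
- move=> x _; rewrite mule_ge0 ?lee_fin ?invr_ge0 ?ler0n// adde_ge0//.
- by apply/measurable_EFinP; exact: measurable_indic.
rewrite integral_indic//; congr (_ + _).
rewrite ge0_integralZl_EFin ?invr_ge0 ?ler0n//; first last.
- exact: emeasurable_funD.
- by move=> x _; rewrite adde_ge0.
congr (_ * _); rewrite ge0_integralD//.
rewrite -[X in X + _ = _]/(\int[mu]_(x in A) (cst (2 ^- N)%:E) x) integral_cst//; congr (_ + _).
rewrite ge0_integral_sum//.
apply: eq_bigr => k _; rewrite ge0_integralZl_EFin//; first by rewrite integral_indic.
by apply/measurable_EFinP; exact: measurable_indic.
Qed.

(** Each of the [N] levels costs at most [3 ^+ n] times [mu F], whatever its height, and the factor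
    [1 / N] reduces their sum to one such term. The constant 2 pays for [1_F] and for the floor
    [2 ^- N], the latter through the hypothesis on [E]. *)
Lemma integral_level_weight_le E : measurable E ->
  (2 ^- N)%:E * mu E <= mu F ->
  \int[mu]_(x in E) (w x)%:E <= (2 + 3 ^+ n)%:E * mu F.
Proof.
move=> mE EF; rewrite integral_level_weight//.
have N1 : ((N%:R^-1)%:E : \bar R) <= 1%:E by rewrite lee_fin invf_le1// ler1n.
have -> : (2 + 3 ^+ n = 1 + (1 + 3 ^+ n) :> R)%R by rewrite addrA.
rewrite !EFinD !ge0_muleDl ?adde_ge0// !mul1e; apply: leeD.
  by apply: le_measure; rewrite ?inE//; exact: measurableI.
rewrite ge0_muleDr ?mule_ge0 ?lee_fin ?(ltW (pow2_gt0 _))//; last first.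
  by apply: sume_ge0 => k _; rewrite mule_ge0// lee_fin ltW// pow2_gt0.
apply: leeD.
  rewrite -[leRHS]mul1e lee_pmul// ?lee_fin ?invr_ge0 ?ler0n//.
  by rewrite mule_ge0// lee_fin ltW// pow2_gt0.
rewrite lee_pdivrMl//.
apply: (@le_trans _ _ (\sum_(k < N) (3 ^+ n)%:E * mu F)).
  apply: lee_sum => k _.
  apply: (@le_trans _ _ ((2 ^- k.+1)%:E * ((3 ^+ n * (2 ^- k.+1)^-1)%:E * mu F))).
    rewrite lee_pmul2l ?lte_fin ?pow2_gt0//.
    apply: le_trans (measure_maximal_set _ _); rewrite ?pow2_gt0//.
    by apply: le_measure; rewrite ?inE//; exact: measurableI.
  by rewrite muleA -EFinM mulrCA divff ?mulr1// gt_eqF// pow2_gt0.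
elim: (N) => [|m IH]; first by rewrite big_ord0 mul0e.
rewrite big_ord_recr /= -[m.+1%:R%R]natr1 EFinD ge0_muleDl// mul1e.
by rewrite leeD2r.
Qed.

End weight.

(** * The A_1 condition for the weight *)

Section weight_A1.
Context {R : realType} {n : nat}.
Local Notation mu := (lebesgue_measure_Rn n).
Local Notation corner := (@rat_corner R n).
Local Notation side := (@rat_side R n).
Local Notation rcube := (@rat_cube R n).
Variables (F : set (Rn R n)) (N : nat).
Hypotheses (mF : measurable F) (N0 : (0 < N)%N).
Local Notation w := (level_weight F N).

Let pow2_gt0 k : (0 < 2 ^- k :> R)%R.
Proof. by rewrite invr_gt0 exprn_gt0. Qed.

Let N0' : (0 < N%:R :> R)%R. Proof. by rewrite ltr0n. Qed.

Let Nw_gt0 (y : Rn R n) : (0 < N%:R * w y)%R.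
Proof. by rewrite mulr_gt0// level_weight_gt0. Qed.

(** The density of [F] in a cube is at most M 1_F at each of its points; the factor 2 is lost
    between dyadic levels. If the density exceeded [2 * (N%:R * w y)], descending the levels one by
    one would give [2 * (N%:R * w y) < 2 ^- N], against the floor. *)
Lemma measureI_rat_cube_le i (y : Rn R n) : (0 < side i)%R -> rcube i y ->
  mu (F `&` rcube i) <= (2 * (N%:R * w y) * side i ^+ n)%:E.
Proof.
move=> i0 yi; rewrite leNgt; apply/negP => Fi.
have mui := measure_rat_cube (ltW i0).
have pi0 : (0 < side i ^+ n)%R by rewrite exprn_gt0.
have main k : (k <= N)%N -> (2 * (N%:R * w y) < 2 ^- k)%R.
  elim: k => [_|k IH kN].
    rewrite expr0 invr1 -(ltr_pM2r pi0) mul1r -lte_fin -mui.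
    by apply: (lt_le_trans Fi); apply: le_measure; rewrite ?inE//; exact: measurableI.
  have [yk|yk] := pselect (maximal_set F (2 ^- k.+1)%R y).
    have := IH (ltnW kN); have := level_weight_maximal N0 kN yk.
    rewrite exprS invfM => h1 h2; exfalso; move: h1 h2; set p := (2 ^- k)%R; lra.
  have : ~ (2 ^- k.+1)%:E * mu (rcube i) < mu (F `&` rcube i).
    by move=> h; apply: yk; exists i.
  move/negP; rewrite -leNgt => /(lt_le_trans Fi).
  by rewrite mui -EFinM lte_fin ltr_pM2r.
have := main N (leqnn N); have := level_weight_ge F N0 y; have := Nw_gt0 y.
by set p := (2 ^- N)%R; lra.
Qed.

(** The triple has side [3 * l] and fits in a rational cube of side at most [6 * l], whence
    [6 ^+ n]. The triple is needed to contain the small cubes that meet [cube a l]. *)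
Lemma measureI_cube_le a l (y : Rn R n) : (0 < l)%R ->
  cube a l y ->
  mu (F `&` cube (fun i => a i - l)%R (3 * l)%R) <=
    (2 * (N%:R * w y) * 6 ^+ n * l ^+ n)%:E.
Proof.
move=> l0 ya.
have l3 : (0 < 3 * l)%R by lra.
have [i [i0 il sub]] := rat_cube_cover (fun i => a i - l)%R l3.
apply: (@le_trans _ _ (mu (F `&` rcube i))).
  by apply: le_measure; rewrite ?inE//; [exact: measurableI|exact: measurableI|exact: setIS].
have yi : rcube i y.
  by apply: sub => j; have := ya j => /andP[? ?]; apply/andP; split; lra.
apply: le_trans (measureI_rat_cube_le i0 yi) _.
rewrite lee_fin -[leRHS]mulrA ler_pM2l ?mulr_gt0 ?level_weight_gt0//.
rewrite -exprMn lerXn2r ?nnegrE ?(ltW i0)//; lra.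
Qed.

(** The summands pay for [1_F], for the floor and for the maximal levels; 18 is the Vitali factor 3
    times 6. *)
Definition A1_const : R := (2 * 6 ^+ n + 1 + 2 * 18 ^+ n)%R.

(* If some cube of [maximal_set F (2 ^- k)] meeting [Q = cube a l] is larger than
   [Q], its triple contains [Q], which bounds [2 ^- k] by [N w y]; otherwise only
   [F] near [Q] matters, and the Vitali bound is applied to that part. *)
Lemma measure_maximal_setI_cube_le k a l (y : Rn R n) : (0 < l)%R -> cube a l y ->
  (2 ^- k)%:E * mu (maximal_set F (2 ^- k) `&` cube a l) <=
    (2 * 18 ^+ n * (N%:R * w y) * l ^+ n)%:E.
Proof.
move=> l0 ya; have ln0 : (0 <= l ^+ n)%R by rewrite exprn_ge0// ltW.
have [[i [li ik iQ]]|near] := pselect (exists i,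
  [/\ (l <= side i)%R, dense_in F (2 ^- k)%R i & rcube i `&` cube a l !=set0]).
  have [i0 idense] := ik.
  have [i' [ci' si']] := rat_cube_tripled (R:=R) (n:=n) i.
  have Pi' : rcube i' = cube (fun j => corner i j - side i)%R (3 * side i)%R.
    by rewrite /rat_cube ci' si'.
  have yi' : rcube i' y by rewrite Pi'; exact: (cube_tripled li iQ).
  have i0' : (0 < side i')%R by rewrite si' mulr_gt0.
  have sub : rcube i `<=` rcube i'.
    move=> x xi; rewrite Pi' => j; have := xi j => /andP[? ?].
    by apply/andP; split; lra.
  have : (2 ^- k)%:E * mu (rcube i) < (2 * (N%:R * w y) * side i' ^+ n)%:E.
    apply: (lt_le_trans idense).
    apply: le_trans (measureI_rat_cube_le i0' yi').
    by apply: le_measure; rewrite ?inE//; [exact: measurableI|exact: measurableI|exact: setIS].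
  rewrite measure_rat_cube ?(ltW i0)// si' exprMn -EFinM lte_fin [ltRHS]mulrA.
  rewrite ltr_pM2r ?exprn_gt0// => kw.
  apply: (@le_trans _ _ ((2 ^- k)%:E * mu (cube a l))).
    by rewrite lee_pmul2l ?lte_fin//; apply: le_measure; rewrite ?inE//; exact: measurableI.
  rewrite measure_cube ?(ltW l0)// -EFinM lee_fin ler_wpM2r//.
  apply: (le_trans (ltW kw)); rewrite mulrAC ler_wpM2r ?(ltW (Nw_gt0 y))//.
  by rewrite ler_wpM2l// lerXn2r ?nnegrE//; lra.
pose a3 i := (a i - l)%R; pose l3 := (3 * l)%R.
apply: (@le_trans _ _ ((2 ^- k)%:E * mu (maximal_set (F `&` cube a3 l3) (2 ^- k)%R))).
  rewrite lee_pmul2l ?lte_fin//; apply: le_measure; rewrite ?inE//; first exact: measurableI.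
  move=> x [[i ik xi] xa]; exists i => //; have [i0 idense] := ik.
  split=> //; apply: (lt_le_trans idense); apply: le_measure; rewrite ?inE//.
  - exact: measurableI.
  - by apply: measurableI => //; exact: measurableI.
  - move=> z [Fz zi]; split=> //; split=> //.
    have [li|il] := leP l (side i); last first.
      by apply: (cube_tripled (ltW il) _ zi); exists x.
    by exfalso; apply: near; exists i; split=> //; exists x.
apply: (@le_trans _ _ ((2 ^- k)%:E * ((3 ^+ n * (2 ^- k)^-1)%:E * mu (F `&` cube a3 l3)))).
  rewrite lee_pmul2l ?lte_fin//; apply: measure_maximal_set => //; exact: measurableI.
rewrite muleA -EFinM mulrCA divff ?gt_eqF// mulr1.
apply: (@le_trans _ _ ((3 ^+ n)%:E * (2 * (N%:R * w y) * 6 ^+ n * l ^+ n)%:E)).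
  by rewrite lee_pmul2l ?lte_fin ?exprn_gt0//; exact: (measureI_cube_le l0).
rewrite -EFinM lee_fin (_ : 18 = 3 * 6)%R ?exprMn; last by rewrite -natrM.
by set A := (3 ^+ n)%R; set B := (6 ^+ n)%R; set C := (N%:R * w y)%R; lra.
Qed.

(** The constant is linear in [N], not quadratic: every level is bounded by a multiple of
    [N%:R * w y], and the factor [1 / N] undoes the summation over the levels. *)
Lemma integral_level_weight_cube_le a l (y : Rn R n) : (0 < l)%R -> cube a l y ->
  \int[mu]_(x in cube a l) (w x)%:E <= (A1_const * N%:R * w y)%:E * mu (cube a l).
Proof.
move=> l0 ya; rewrite integral_level_weight// measure_cube ?(ltW l0)//.
have ln0 : (0 <= l ^+ n)%R by rewrite exprn_ge0// ltW.
rewrite -[leRHS]EFinM.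
have -> : (A1_const * N%:R * w y * l ^+ n =
    2 * (N%:R * w y) * 6 ^+ n * l ^+ n +
    (N%:R * w y * l ^+ n + 2 * 18 ^+ n * (N%:R * w y) * l ^+ n))%R.
  rewrite /A1_const.
  by set A := (18 ^+ n)%R; set B := (6 ^+ n)%R; set C := (l ^+ n)%R; lra.
rewrite EFinD; apply: leeD.
  apply: le_trans (measureI_cube_le l0 ya).
  apply: le_measure; rewrite ?inE//; [exact: measurableI|exact: measurableI|].
  apply: setIS => x xa j; have := xa j => /andP[? ?].
  by apply/andP; split; lra.
rewrite lee_pdivrMl// EFinD ge0_muleDr ?lee_fin; last 2 first.
- by rewrite mulr_ge0// ltW.
- by rewrite mulr_ge0// mulr_ge0 ?(ltW (Nw_gt0 y))// mulr_ge0// exprn_ge0.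
apply: leeD.
  rewrite -!EFinM lee_fin mulrA ler_wpM2r//.
  apply: (le_trans (level_weight_ge F N0 y)).
  by rewrite ler_peMl ?ler1n// ltW.
set c := (2 * _ * _ * _)%R.
rewrite [leRHS](_ : _ = \sum_(k < N) c%:E); last first.
  by rewrite sumEFin sumr_const card_ord -EFinM mulr_natl.
by apply: lee_sum => k _; exact: measure_maximal_setI_cube_le.
Qed.

End weight_A1.

(** * From A_1 to A_p, with the same constant *)

Section Ap_of_A1.
Context {R : realType} {n : nat}.
Local Notation mu := (lebesgue_measure_Rn n).
Implicit Types (a : 'I_n -> R) (l c : R) (f : Rn R n -> R) (x y : Rn R n).
Variables (p K m : R) (u : Rn R n -> R).
Hypotheses (p1 : (1 < p)%R) (K0 : (0 < K)%R) (m0 : (0 < m)%R).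
Hypotheses (mu_ : measurable_fun setT u) (um : forall x, (m <= u x)%R).
Hypothesis uA1 : forall a l y, (0 < l)%R -> cube a l y ->
  \int[mu]_(x in cube a l) (u x)%:E <= (K * u y)%:E * mu (cube a l).

Let u0 x : (0 < u x)%R. Proof. exact: lt_le_trans (um x). Qed.

Let r := ((p - 1)^-1)%R.
Let r0 : (0 < r)%R. Proof. by rewrite invr_gt0 subr_gt0. Qed.

Let v x := (u x `^ (- r))%R.

Let mv : measurable_fun setT v.
Proof. exact: (measurableT_comp (measurable_powR (- r)) mu_). Qed.

Let cube_center a l : (0 < l)%R -> cube a l [tuple a i | i < n].
Proof. by move=> l0 i; rewrite tnth_mktuple lexx lerDl ltW. Qed.

Let averageE a l f : (0 < l)%R ->
  average (cube a l) f = ((l ^+ n)^-1)%:E * \int[mu]_(x in cube a l) (f x)%:E.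
Proof. by move=> l0; rewrite /average measure_cube ?(ltW l0). Qed.

Let average_le a l f c : (0 < l)%R -> measurable_fun setT f ->
  (forall x, cube a l x -> 0 <= f x <= c)%R -> average (cube a l) f <= c%:E.
Proof.
move=> l0 mf fc; rewrite averageE// lee_pdivrMl ?exprn_gt0//.
rewrite muleC -(measure_cube a (ltW l0)) -integral_cst//.
apply: ge0_le_integral => //.
- by move=> x /fc /andP[]; rewrite lee_fin.
- by apply/measurable_EFinP; exact: measurable_funTS.
- by move=> x /fc /andP[_]; rewrite lee_fin.
Qed.

Let average_fin a l : (0 < l)%R -> exists alpha : R,
  [/\ (0 < alpha)%R, average (cube a l) u = alpha%:E &
      forall y, cube a l y -> (alpha <= K * u y)%R].
Proof.
move=> l0; have ln0 : (0 < l ^+ n)%R by rewrite exprn_gt0.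
have lb : m%:E <= average (cube a l) u.
  rewrite averageE// lee_pdivlMl// muleC -(measure_cube a (ltW l0)) -integral_cst//.
  apply: ge0_le_integral => //; first by move=> x _; rewrite lee_fin ltW.
    by apply/measurable_EFinP; exact: measurable_funTS.
  by move=> x _; rewrite lee_fin.
have ub y : cube a l y -> average (cube a l) u <= (K * u y)%:E.
  move=> ya; rewrite averageE// lee_pdivrMl// muleC -(measure_cube a (ltW l0)).
  exact: uA1.
have := ub _ (cube_center _ l0); move: lb ub; case: (average _ _) => // alpha.
rewrite lee_fin => malpha ub _; exists alpha; split=> //; exact: lt_le_trans malpha.
Qed.

(** On a cube with mean [alpha], [u] is at least [alpha / K]. Since [r * (p - 1) = 1], the dual mean
    raised to the power [p - 1] is at most [K / alpha]. *)
Lemma Ap_norm_le : Ap_norm p u <= K%:E.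
Proof.
apply: ge_ereal_sup => _ [_ [a [l [l0 ->]]] <-]; rewrite -/(cube a l) -/r -/v.
have [alpha [alpha0 -> alphaK]] := average_fin a l0.
have le_v : average (cube a l) v <= ((alpha / K) `^ (- r))%:E.
  apply: average_le => // x xa; rewrite powR_ge0 /= /v !powRN.
  rewrite lef_pV2 ?posrE ?powR_gt0 ?divr_gt0//.
  rewrite ge0_ler_powR ?nnegrE ?(ltW r0) ?(ltW (u0 _)) ?divr_ge0 ?(ltW alpha0) ?(ltW K0)//.
  by rewrite ler_pdivrMr// mulrC; exact: alphaK.
have v0 : 0 <= average (cube a l) v.
  rewrite averageE// mule_ge0 ?lee_fin ?invr_ge0 ?exprn_ge0 ?(ltW l0)//.
  by apply: integral_ge0 => x _; rewrite lee_fin powR_ge0.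
apply: (@le_trans _ _ (alpha%:E * ((alpha / K) `^ (- r))%:E `^ (p - 1))).
  rewrite lee_pmul2l ?lte_fin//; apply: gt0_ler_poweR => //; first by rewrite subr_ge0 ltW.
    by rewrite in_itv /= leey andbT.
  by rewrite in_itv /= leey andbT lee_fin powR_ge0.
have -> : (((alpha / K) `^ (- r))%:E `^ (p - 1) = (alpha / K)^-1%:E :> \bar R).
  rewrite poweR_EFin -powRrM mulNr mulVf ?powRN; last by rewrite subr_eq0 gt_eqF.
  by rewrite powRr1// divr_ge0 ?ltW.
by rewrite -EFinM invf_div mulrCA divff ?mulr1// gt_eqF.
Qed.

(** The convex function with exponent [- r'] lies above its tangent at 1; integrated, this acts as
    Jensen's inequality. *)
Lemma powRN_tangent (r' x : R) : (0 < x)%R -> (0 <= r')%R ->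
  (1 + r' <= x `^ (- r') + r' * x)%R.
Proof.
move=> x0 r'0; rewrite /powR gt_eqF//.
have := expR_ge1Dx (- r' * ln x)%R; have := ln_sublinear x0 => h1 h2.
have h3 : (ln x <= x - 1)%R.
  by rewrite lerBrDl -[leRHS](lnK x0); exact: expR_ge1Dx.
have h4 : (r' * ln x <= r' * (x - 1))%R by rewrite ler_wpM2l.
by move: h2; rewrite mulNr; lra.
Qed.

(** Needed because [phi] is controlled on [1, +oo[ only. On the unit cube, the tangent inequality at
    [u x / alpha] bounds the dual mean from below. *)
Lemma Ap_norm_ge1 : 1 <= Ap_norm p u.
Proof.
pose a (_ : 'I_n) := 0%R : R.
apply: (@le_trans _ _ (average (cube a 1%R) u * (average (cube a 1%R) v) `^ (p - 1))); last first.
  by apply: ereal_sup_ubound; exists (cube a 1%R) => //; exists a, 1%R.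
have [alpha [alpha0 aE _]] := average_fin a ltr01.
have muQ : mu (cube a 1%R) = 1 by rewrite measure_cube// expr1n.
have intu : \int[mu]_(x in cube a 1%R) (u x)%:E = alpha%:E.
  by rewrite -aE averageE// expr1n invr1 mul1e.
have le_v : (alpha `^ (- r))%:E <= average (cube a 1%R) v.
  rewrite averageE// expr1n invr1 mul1e.
  have : (alpha `^ (- r) * (1 + r))%:E <=
      \int[mu]_(x in cube a 1%R) (v x)%:E + (alpha `^ (- r) * r)%:E.
    (* Writing the constant as an integral of a multiple of [u] allows a pointwise comparison of
       sums, with no subtraction of possibly infinite integrals. *)
    have -> : (alpha `^ (- r) * r)%:E =
        (alpha `^ (- r) * r / alpha)%:E * \int[mu]_(x in cube a 1%R) (u x)%:E.
      by rewrite intu -EFinM divfK ?gt_eqF.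
    rewrite -ge0_integralZl_EFin//; first last.
    - by rewrite !mulr_ge0 ?(ltW r0) ?invr_ge0 ?powR_ge0 ?(ltW alpha0).
    - by apply/measurable_EFinP; exact: measurable_funTS.
    - by move=> x _; rewrite lee_fin ltW.
    rewrite -ge0_integralD//; first last.
    - apply: emeasurable_funM => //.
      by apply/measurable_EFinP; exact: measurable_funTS.
    - by move=> x _; rewrite -EFinM lee_fin !mulr_ge0 ?(ltW r0) ?invr_ge0 ?powR_ge0 ?(ltW alpha0) ?(ltW (u0 x)).
    - by apply/measurable_EFinP; exact: measurable_funTS.
    - by move=> x _; rewrite lee_fin powR_ge0.
    rewrite -[leLHS]mule1 -muQ -integral_cst//.
    apply: ge0_le_integral => //.
    - by move=> x _; rewrite lee_fin mulr_ge0 ?powR_ge0// addr_ge0// ltW.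
    - apply: emeasurable_funD; last apply: emeasurable_funM => //;
        by apply/measurable_EFinP; exact: measurable_funTS.
    - move=> x _; rewrite -EFinM -EFinD lee_fin.
      have xa0 : (0 < u x / alpha)%R by rewrite divr_gt0.
      have := ler_wpM2l (powR_ge0 alpha (- r)) (powRN_tangent xa0 (ltW r0)).
      move=> /le_trans; apply.
      rewrite mulrDr lerD//; last by rewrite (mulrC (u x)) !mulrA.
      rewrite -powRM ?(ltW alpha0) ?(ltW xa0)//.
      by rewrite /v mulrCA divff ?gt_eqF// mulr1.
  case: (\int[mu]_(x in _) _) => [I| _|]; last by rewrite addNye leeNy_eq.
    by rewrite -EFinD !lee_fin mulrDr mulr1; lra.
  by rewrite leey.
apply: (@le_trans _ _ (alpha%:E * ((alpha `^ (- r))%:E `^ (p - 1)))).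
  rewrite poweR_EFin -powRrM mulNr mulVf ?powRN; last by rewrite subr_eq0 gt_eqF.
  by rewrite powRr1 ?(ltW alpha0)// -EFinM divff// gt_eqF.
rewrite aE lee_pmul2l ?lte_fin//; apply: gt0_ler_poweR => //; first by rewrite subr_ge0 ltW.
  by rewrite in_itv /= leey andbT lee_fin powR_ge0.
rewrite in_itv /= leey andbT; apply: le_trans le_v.
by rewrite lee_fin powR_ge0.
Qed.

End Ap_of_A1.

(** * Monotonicity and scaling of admissible functions *)

Section admissible_functions.
Context {R : realType}.
Implicit Types (phi : R -> R) (x y z : R).

(** A concave function on a half-line that decreases somewhere tends to -oo, while [ln (phi _)] is
    nonnegative. *)
Lemma admissible_nondecreasing phi x y : admissible phi ->
  (1 <= x)%R -> (x <= y)%R -> (phi x <= phi y)%R.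
Proof.
move=> [phi1 _ phi_concave _] x1; rewrite le_eqVlt => /predU1P[->//|xy].
have y1 : (1 <= y)%R by lra.
have phi_pos z : (1 <= z)%R -> phi z \is Num.pos.
  by move=> /phi1 z1; rewrite posrE; lra.
have gge0 z : (1 <= z)%R -> (0 <= ln (phi z))%R by move=> /phi1/ln_ge0.
rewrite -ler_ln ?phi_pos// leNgt; apply/negP => gyx.
have gx0 := le_lt_trans (gge0 _ y1) gyx.
have gy0 := gge0 _ y1.
set gx := ln (phi x) in gyx gx0; set gy := ln (phi y) in gyx gy0.
(* Chosen so that [theta * gx] is the midpoint of [gx] and [gy], hence above [gy]; [z] is the far
   point making [y] the corresponding barycentre. *)
pose theta := ((gx + gy) / (2 * gx))%R.
have thetaE : (theta * gx = (gx + gy) / 2)%R by rewrite /theta; field; lra.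
have theta0 : (0 <= theta)%R by rewrite divr_ge0//; lra.
have theta1 : (theta < 1)%R by rewrite ltr_pdivrMr; lra.
pose z := ((y - theta * x) / (1 - theta))%R.
have yz : (y <= z)%R.
  by rewrite ler_pdivlMr; [nra|lra].
have yE : (theta * x + (1 - theta) * z = y)%R by rewrite /z; field; lra.
have z1 : (1 <= z)%R by lra.
have := @phi_concave x z theta x1 z1; rewrite theta0 (ltW theta1) yE => /(_ isT).
rewrite -/gx -/gy thetaE; have : (0 <= (1 - theta) * ln (phi z))%R.
  by rewrite mulr_ge0 ?gge0//; lra.
lra.
Qed.

(* By concavity, the slope of [ln phi] on [[x, K x]] is at most its derivative at x. *)
Lemma admissible_scale phi : admissible phi -> exists2 B : R, (0 < B)%R &
  forall K x, (1 <= K)%R -> (1 <= x)%R -> (phi (K * x) <= expR (B * (K - 1)) * phi x)%R.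
Proof.
move=> [phi1 _ phi_concave [gamma [beta [_ beta0 dphiP]]]].
exists beta => // K x; rewrite le_eqVlt => /predU1P[<-|K1] x1.
  by rewrite subrr mulr0 expR0 !mul1r.
have pos z : (1 <= z)%R -> (0 < phi z)%R by move=> /phi1; lra.
set y := (K * x)%R.
have xy : (x < y)%R by rewrite /y; nra.
have y1 : (1 <= y)%R by lra.
pose S := ((ln (phi y) - ln (phi x)) / (y - x))%R.
have slope z : (x < z < y)%R -> (S * phi x <= (phi z - phi x) / (z - x))%R.
  move=> /andP[xz zy].
  have z1 : (1 <= z)%R by lra.
  pose theta := ((y - z) / (y - x))%R.
  have theta01 : (0 <= theta <= 1)%R.
    by rewrite /theta divr_ge0 ?ler_pdivrMr /=; lra.
  have zE : (theta * x + (1 - theta) * y = z)%R by rewrite /theta; field; lra.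
  have := phi_concave x y theta x1 y1 theta01; rewrite zE => gz.
  have gz' : (ln (phi x) + S * (z - x) <= ln (phi z))%R.
    apply: le_trans gz; rewrite le_eqVlt; apply/orP; left; apply/eqP.
    by rewrite /S /theta; field; lra.
  rewrite ler_pdivlMr ?subr_gt0//.
  (* The inequality exp s >= 1 + s converts the chord slope [S] of [ln phi] into a bound on
     difference quotients of [phi] itself, whose limit is what admissibility controls. *)
  have : (phi x * (1 + S * (z - x)) <= phi z)%R.
    rewrite -[leRHS]lnK ?posrE ?pos//.
    apply: le_trans (_ : expR (ln (phi x) + S * (z - x)) <= _)%R; last by rewrite ler_expR.
    by rewrite expRD lnK ?posrE ?pos// ler_pM2l ?pos// expR_ge1Dx.
  by lra.
have [d [dlim /andP[_ dphi]]] := dphiP x x1.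
have Sd : (S * phi x <= d)%R.
  rewrite leNgt; apply/negP => dS.
  move/cvgrPdist_lt: dlim => /(_ (S * phi x - d)%R); rewrite subr_gt0 => /(_ dS).
  move=> [e /= e0 eP].
  pose z := (x + Num.min (e / 2) ((y - x) / 2))%R.
  have m0 : (0 < Num.min (e / 2) ((y - x) / 2))%R by rewrite lt_min; apply/andP; split; lra.
  have m1 : (Num.min (e / 2) ((y - x) / 2) <= e / 2)%R by rewrite ge_min lexx.
  have m2 : (Num.min (e / 2) ((y - x) / 2) <= (y - x) / 2)%R by rewrite ge_min lexx orbT.
  have := eP z; rewrite /ball /= /z opprD addrA subrr add0r normrN gtr0_norm//.
  have e2 : (Num.min (e / 2) ((y - x) / 2) < e)%R by lra.
  move=> /(_ e2); rewrite -/z.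
  have zx : z != x by rewrite /z; apply/eqP; lra.
  have z1 : (1 <= z)%R by rewrite /z; lra.
  move=> /(_ zx z1).
  have xzy : (x < z < y)%R by rewrite /z; apply/andP; split; lra.
  by have := slope z xzy => h1; rewrite ltr_norml => /andP[h2 _]; lra.
have Sb : (S <= beta / x)%R.
  apply: le_trans dphi; rewrite ler_pdivlMr ?pos//.
have gy : (ln (phi y) <= beta * (K - 1) + ln (phi x))%R.
  have : (S * (y - x) <= beta / x * (y - x))%R by rewrite ler_pM2r// subr_gt0.
  have -> : (S * (y - x) = ln (phi y) - ln (phi x))%R by rewrite /S; field; lra.
  have -> : (beta / x * (y - x) = beta * (K - 1))%R by rewrite /y; field; lra.
  lra.
by rewrite -[leLHS]lnK ?posrE ?pos// -[X in (_ * X)%R](lnK _) ?posrE ?pos// -expRD ler_expR.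
Qed.

End admissible_functions.

(** * Superlevel sets and Lorentz norms *)

Section measure_lemmas.
Context {R : realType}.

Lemma nonincreasing_emeasurable (D : set R) (f : R -> \bar R) : measurable D ->
  {homo f : x y / (x <= y)%R >-> y <= x} -> measurable_fun D f.
Proof.
move=> mD f_ni; apply: (measurability _ (ErealGenOInfty.measurableE R)).
move=> _ [_ [x ->] <-]; apply: measurableI => //.
apply: is_interval_measurable => s t /=.
rewrite !in_itv /= !andbT => fs ft u /andP[su ut].
by rewrite in_itv /= andbT (lt_le_trans ft)// f_ni.
Qed.

Context d (X : measurableType d) (nu : {measure set X -> \bar R}).

Lemma measurable_superlevel (h : X -> \bar R) (y : \bar R) : measurable_fun setT h ->
  measurable [set x | y < `|h x|].
Proof.
move=> mh; rewrite -[X in measurable X]setTI; apply: emeasurable_fun_o_infty => //.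
exact: measurableT_comp.
Qed.

(** Continuity from below along the levels [c + 1 / (k + 1)]. Later bounds can thus be tested at
    levels strictly above [c], which are positive when [c] is 0. *)
Lemma measure_gt_right_continuous (h : X -> \bar R) (c : R) (tau : \bar R) :
  measurable_fun setT h ->
  (forall y : R, (c < y)%R -> nu [set x | y%:E < `|h x|] <= tau) ->
  nu [set x | c%:E < `|h x|] <= tau.
Proof.
move=> mh htau; pose G k := [set x | (c + k.+1%:R^-1)%:E < `|h x|].
have -> : [set x | c%:E < `|h x|] = \bigcup_k G k.
  apply/seteqP; split => x /=; last first.
    by move=> [k _]; apply: le_lt_trans; rewrite lee_fin lerDl.
  case E : (`|h x|) => [r| |//].
  - rewrite lte_fin => /ltr_add_invr[k ck]; exists k => //.
    by rewrite /G /mkset E lte_fin.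
  - by exists 0%N => //; rewrite /G /mkset E ltry.
have mG k : measurable (G k) by exact: measurable_superlevel.
have cvG : nu \o G @ \oo --> nu (\bigcup_k G k).
  apply: nondecreasing_cvg_mu => //; first exact: bigcup_measurable.
  move=> k1 k2 k12; apply/subsetPset => x; apply: le_lt_trans.
  by rewrite lee_fin lerD2l lef_pV2 ?posrE// ler_nat.
rewrite -(cvg_lim _ cvG)//; apply: lime_le; first by apply/cvg_ex; eexists; exact: cvG.
by apply: nearW => k /=; apply: htau; rewrite ltrDl.
Qed.

(** A superlevel set may have infinite measure, but the weighted estimate ends by cancelling a power
    of [mu F]; sigma-finiteness provides a finite piece still above [tau]. *)
Lemma exists_finite_measure_subset (G : set X) (tau : \bar R) :
  sigma_finite setT nu -> measurable G -> tau < nu G ->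
  exists2 F, measurable F /\ F `<=` G & tau < nu F < +oo.
Proof.
move=> /sigma_finiteP[B [BT ndB Bfin]] mG tauG.
have mGB k : measurable (G `&` B k) by apply: measurableI => //; have [] := Bfin k.
have cvG : nu \o (fun k => G `&` B k) @ \oo --> nu (\bigcup_k (G `&` B k)).
  apply: nondecreasing_cvg_mu => //; first exact: bigcup_measurable.
  by move=> k1 k2 k12; apply/subsetPset; apply: setIS; exact/subsetPset/ndB.
have [[k tauk]|nk] := pselect (exists k, tau < nu (G `&` B k)).
  exists (G `&` B k) => //; rewrite tauk /=; have [mB] := Bfin k; apply: le_lt_trans.
  by apply: le_measure; rewrite ?inE.
exfalso; move: tauG; apply/negP; rewrite -leNgt.
rewrite (_ : G = \bigcup_k (G `&` B k)); last by rewrite -setI_bigcupr -BT setIT.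
rewrite -(cvg_lim _ cvG)//; apply: lime_le; first by apply/cvg_ex; eexists; exact: cvG.
by apply: nearW => k /=; rewrite leNgt; apply/negP => ?; apply: nk; exists k.
Qed.

End measure_lemmas.

Section lorentz_lemmas.
Context {R : realType} {n : nat}.
Local Notation mu := (lebesgue_measure_Rn n).
Implicit Types (u f : Rn R n -> R) (h : Rn R n -> \bar R).

Lemma distribution_function_nonincreasing u f : measurable_fun setT u ->
  (forall x, 0 <= u x)%R -> measurable_fun setT f ->
  {homo distribution_function (wmeasure u) (EFin \o f) : x y / (x <= y)%R >-> y <= x}.
Proof.
move=> mu_ u0 mf x y xy; apply: ge0_subset_integral.
- by apply: measurable_superlevel; exact/measurable_EFinP.
- by apply: measurable_superlevel; exact/measurable_EFinP.
- by apply/measurable_EFinP; exact: measurable_funTS.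
- by move=> z _; rewrite lee_fin.
- by move=> z /=; apply: le_lt_trans; rewrite lee_fin.
Qed.

Lemma lorentz_p1_le u f (p a : R) (E : set (Rn R n)) : measurable_fun setT u ->
  (forall x, 0 <= u x)%R -> measurable_fun setT f -> measurable E ->
  (0 < p)%R -> (0 <= a)%R ->
  (forall x, `|f x| <= a)%R -> (forall x, ~ E x -> f x = 0%R) ->
  lorentz_p1 (wmeasure u) p (EFin \o f) <= a%:E * (wmeasure u E) `^ p^-1.
Proof.
move=> mu_ u0 mf mE p0 a0 fa fE; rewrite /lorentz_p1.
set D := distribution_function _ _.
have Dni := distribution_function_nonincreasing mu_ u0 mf; rewrite -/D in Dni.
have D0 y : 0 <= D y by apply: integral_ge0 => x _; rewrite lee_fin.
have Dp_ni : {homo (fun y => D y `^ p^-1) : x y / (x <= y)%R >-> y <= x}.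
  move=> x y xy; apply: gt0_ler_poweR; rewrite ?invr_ge0 ?(ltW p0)//.
  - by rewrite in_itv /= leey D0.
  - by rewrite in_itv /= leey D0.
  - exact: Dni.
have mDp (A : set R) : measurable A -> measurable_fun A (fun y => D y `^ p^-1).
  by move=> mA; exact: nonincreasing_emeasurable.
have uE0 : 0 <= wmeasure u E by apply: integral_ge0 => x _; rewrite lee_fin.
pose A : set (measurableTypeR R) := `]0%R, a[%classic.
have mA : measurable A by exact: measurable_itv.
pose c := wmeasure u E `^ p^-1.
have c0 : 0 <= c by exact: poweR_ge0.
apply: (@le_trans _ _ (\int[lebesgue_measure]_(y in `]0%R, +oo[) (c * (\1_A y)%:E))).
  apply: ge0_le_integral => //.
  - by move=> y _; exact: poweR_ge0.
  - exact: mDp.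
  - apply: emeasurable_funM => //; apply/measurable_EFinP.
    exact: measurable_indic.
  - move=> y /=; rewrite in_itv /= andbT => y0.
    have [ya|ay] := ltP y a.
      rewrite indicE mem_set ?mule1; last by rewrite /A /= in_itv /= y0.
      apply: gt0_ler_poweR; rewrite ?invr_ge0 ?(ltW p0) ?in_itv /= ?leey ?D0 ?uE0//.
      apply: ge0_subset_integral => //.
      + by apply: measurable_superlevel; exact/measurable_EFinP.
      + by apply/measurable_EFinP; exact: measurable_funTS.
      + by move=> z _; rewrite lee_fin.
      + move=> x /=; rewrite lte_fin => yf; apply: contrapT => /fE fx0.
        by move: yf; rewrite fx0 normr0 ltNge ltW.
    suff -> : D y = 0 by rewrite poweR0r ?mule_ge0// invr_eq0 gt_eqF.
    rewrite /D /distribution_function (_ : [set x | _] = set0) ?/wmeasure ?integral_set0//.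
    apply/seteqP; split => // x /=; rewrite lte_fin => yf.
    by have := lt_le_trans yf (fa x); rewrite ltNge ay.
rewrite ge0_integralZl//; last by apply/measurable_EFinP; exact: measurable_indic.
rewrite integral_indic// muleC; apply: lee_pmul => //.
apply: (@le_trans _ _ (lebesgue_measure A)).
  by apply: le_measure; rewrite ?inE//; exact: measurableI.
rewrite lebesgue_measure_itv /= lte_fin.
by case: ltP => [_|a0']; rewrite -?EFinB ?subr0// lee_fin.
Qed.

End lorentz_lemmas.

(** * The estimate for one bounded layer *)

Section layer_estimate.
Context {R : realType} {n : nat}.
Local Notation mu := (lebesgue_measure_Rn n).

Lemma level_weight_Ap (F : set (Rn R n)) (N : nat) (p : R) : (1 < p)%R ->
  measurable F -> (0 < N)%N ->
  Ap p (level_weight F N : Rn R n -> R) /\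
  1 <= Ap_norm p (level_weight F N) <= (@A1_const R n * N%:R)%:E.
Proof.
move=> p1 mF N0; set w := level_weight F N.
have N0' : (0 < N%:R :> R)%R by rewrite ltr0n.
have m0 : (0 < 2 ^- N / N%:R :> R)%R by rewrite divr_gt0// invr_gt0 exprn_gt0.
have wm (x : Rn R n) : (2 ^- N / N%:R <= w x)%R.
  by rewrite ler_pdivrMr// mulrC; exact: level_weight_ge.
have K0 : (0 < @A1_const R n * N%:R)%R.
  by rewrite mulr_gt0// addr_gt0 ?addr_gt0 ?mulr_gt0 ?exprn_gt0.
have mw : measurable_fun setT w by exact: measurable_level_weight.
have wA1 a l (y : Rn R n) : (0 < l)%R -> cube a l y ->
    \int[mu]_(x in cube a l) (w x)%:E <=
    (@A1_const R n * N%:R * w y)%:E * mu (cube a l).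
  exact: integral_level_weight_cube_le.
have le1 := Ap_norm_le p1 K0 m0 mw wm wA1.
have ge1 := Ap_norm_ge1 p1 m0 mw wm wA1.
split; last by rewrite ge1.
split; last by apply: le_lt_trans le1 _; rewrite ltry.
split=> //; first by move=> x; rewrite ltW// (lt_le_trans m0).
by apply: aeW => x; exact: lt_le_trans (wm x).
Qed.

Lemma layer_estimate (T : (Rn R n -> R) -> Rn R n -> \bar R) (p0 C : R) (phi : R -> R) :
  (forall f, measurable_fun setT f -> measurable_fun setT (T f)) ->
  (1 < p0)%R -> (0 < C)%R -> admissible phi ->
  (forall u : Rn R n -> R, Ap p0 u ->
    forall f : Rn R n -> R, measurable_fun [set: Rn R n] f ->
      lorentz_pinfty (wmeasure u) p0 (T f) <=
      (C * phi (fine (Ap_norm p0 u)))%:E * lorentz_p1 (wmeasure u) p0 (EFin \o f)) ->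
  forall (g : Rn R n -> R) (E : set (Rn R n)) (a tau : R) (N : nat),
    measurable_fun setT g -> measurable E -> (0 <= a)%R -> (0 < tau)%R -> (0 < N)%N ->
    (forall x, `|g x| <= a)%R -> (forall x, ~ E x -> g x = 0%R) ->
    mu E <= (2 ^+ N * tau)%:E ->
    mu [set x | (C * (2 + 3 ^+ n) * phi (@A1_const R n * N%:R) * a)%:E < `|T g x|] <= tau%:E.
Proof.
move=> mT p0_gt1 C0 phiA Tw g E a tau N mg mE a0 tau0 N0 ga gE muE.
set c := (C * _ * _ * a)%R.
apply: measure_gt_right_continuous => [|y cy]; first exact: mT.
rewrite leNgt; apply/negP => tauG.
set G := [set x | _] in tauG.
have mG : measurable G by apply: measurable_superlevel; exact: mT.
have [F [mF FG] /andP[tauF Foo]] := exists_finite_measure_subset (sigma_finiteT mu) mG tauG.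
have [wAp /andP[w1 wN]] := level_weight_Ap p0_gt1 mF N0.
set w := level_weight F N in wAp w1 wN.
have w0 x : (0 <= w x)%R by rewrite ltW// level_weight_gt0.
have mw : measurable_fun setT w by exact: measurable_level_weight.
have p00 : (0 < p0)%R by rewrite (lt_trans _ p0_gt1).
have r0 : (0 <= p0^-1)%R by rewrite invr_ge0 ltW.
have A1N : (1 <= @A1_const R n * N%:R)%R.
  apply: mulr_ege1; last by rewrite ler1n.
  by rewrite /A1_const -addrA addrCA lerDl addr_ge0// mulr_ge0// exprn_ge0.
have [phi1 _ _ _] := phiA.
have phiw : (phi (fine (Ap_norm p0 w)) <= phi (@A1_const R n * N%:R))%R.
  move: w1 wN; case: (Ap_norm p0 w) => // s; rewrite !lee_fin => s1 sN.
  exact: admissible_nondecreasing.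
have phi0 : (0 <= phi (@A1_const R n * N%:R))%R by rewrite (le_trans _ (phi1 _ A1N)).
have c0 : (0 <= c)%R by rewrite !mulr_ge0 ?addr_ge0 ?exprn_ge0 ?(ltW C0).
have y0 : (0 < y)%R by exact: le_lt_trans cy.
(* The choice of [F] gives [2 ^- N * mu E <= tau < mu F], as the floor of the weight requires. *)
have wE : wmeasure w E <= (2 + 3 ^+ n)%:E * mu F.
  apply: integral_level_weight_le => //; apply: le_trans (ltW tauF).
  by rewrite muleC lee_pdivrMr ?exprn_gt0// -EFinM mulrC.
have wG : mu F <= wmeasure w G.
  apply: (@le_trans _ _ (\int[mu]_(x in F) (w x)%:E)).
    rewrite -[leLHS]mul1e -integral_cst//; apply: ge0_le_integral => //.
      by apply/measurable_EFinP; exact: measurable_funTS.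
    by move=> x Fx; rewrite lee_fin; exact: level_weight_ge1.
  apply: ge0_subset_integral => //.
    by apply/measurable_EFinP; exact: measurable_funTS.
  by move=> x _; rewrite lee_fin.
have wE0 : 0 <= wmeasure w E by apply: integral_ge0 => x _; rewrite lee_fin.
have wG0 : 0 <= wmeasure w G by apply: integral_ge0 => x _; rewrite lee_fin.
have Ffin : mu F \is a fin_num by rewrite ge0_fin_numE.
have {}tauF : tau%:E < mu F := tauF.
move: tauF wE wG; rewrite -(fineK Ffin); set m := fine _; rewrite lte_fin => taum wE wG.
have m0 : (0 < m)%R by exact: lt_trans taum.
have := Tw w wAp g mg.
have lepi : (y * m `^ p0^-1)%:E <= lorentz_pinfty (wmeasure w) p0 (T g).
  apply: (@le_trans _ _ (y%:E * wmeasure w G `^ p0^-1)); last first.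
    by apply: ereal_sup_ubound; exists y.
  rewrite EFinM lee_pmul2l ?lte_fin// -poweR_EFin.
  by apply: gt0_ler_poweR; rewrite ?in_itv /= ?leey ?andbT ?lee_fin ?(ltW m0).
have lep1 := lorentz_p1_le mw w0 mg mE p00 a0 ga gE.
(* As [p0^-1 <= 1] and [2 + 3 ^+ n >= 1], the root of the constant is bounded by the constant
   itself. *)
have le1 : wmeasure w E `^ p0^-1 <= ((2 + 3 ^+ n) * m `^ p0^-1)%:E.
  apply: (@le_trans _ _ (((2 + 3 ^+ n) * m)%:E `^ p0^-1)).
    apply: gt0_ler_poweR; rewrite ?in_itv /= ?leey ?andbT ?wE0 ?lee_fin//.
    by rewrite mulr_ge0 ?addr_ge0 ?exprn_ge0 ?(ltW m0).
  rewrite poweR_EFin lee_fin powRM ?(ltW m0) ?addr_ge0 ?exprn_ge0//.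
  rewrite ler_wpM2r ?powR_ge0// ler1_powR//.
    by rewrite ler_wpDr ?exprn_ge0// ler1n.
  by rewrite invf_le1// ltW.
move=> /(le_trans lepi).
have : (C * phi (fine (Ap_norm p0 w)))%:E * lorentz_p1 (wmeasure w) p0 (EFin \o g) <=
    (C * phi (@A1_const R n * N%:R))%:E * (a%:E * ((2 + 3 ^+ n) * m `^ p0^-1)%:E).
  apply: lee_pmul.
  - rewrite lee_fin mulr_ge0 ?(ltW C0)//.
    move: w1 wN; case: (Ap_norm p0 w) => // s; rewrite !lee_fin => s1 sN /=.
    by rewrite (le_trans _ (phi1 _ s1)).
  - by apply: integral_ge0 => z _; exact: poweR_ge0.
  - by rewrite lee_fin ler_wpM2l ?(ltW C0).
  - by apply: (le_trans lep1); rewrite lee_wpmul2l ?lee_fin.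
move=> h1 /le_trans/(_ h1); rewrite -!EFinM lee_fin => h2.
have mr0 : (0 < m `^ p0^-1)%R by exact: powR_gt0.
move: h2; rewrite (_ : C * _ * _ = c * m `^ p0^-1)%R; last first.
  by rewrite /c; ring.
by rewrite ler_pM2r// leNgt cy.
Qed.

End layer_estimate.

Section series_of_integrals.
Context d (X : measurableType d) (R : realType) (nu : {measure set X -> \bar R}).

Lemma trivIset_lt (D : nat -> set X) :
  (forall i j, (i < j)%N -> D i `&` D j = set0) -> trivIset setT D.
Proof.
move=> DD; apply/trivIsetP => i j _ _.
by rewrite neq_ltn => /orP[/DD//|/DD]; rewrite setIC.
Qed.

Lemma nneseries_integral_le (D : nat -> set X) (A : set X) (g : X -> \bar R) :
  (forall k, measurable (D k)) -> (forall i j, (i < j)%N -> D i `&` D j = set0) ->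
  measurable A -> (forall k, D k `<=` A) ->
  measurable_fun A g -> (forall x, A x -> 0 <= g x) ->
  \sum_(k <oo) \int[nu]_(x in D k) g x <= \int[nu]_(x in A) g x.
Proof.
move=> mD DD mA DA mg g0.
have UA : \bigcup_k D k `<=` A by move=> x [k _ /DA].
have mU : measurable (\bigcup_k D k) by exact: bigcup_measurable.
rewrite -ge0_integral_bigcup//.
- exact: ge0_subset_integral.
- exact: measurable_funS mg.
- by move=> x /UA/g0.
- exact: trivIset_lt.
Qed.

Lemma integral_ge_cst (D A : set X) (g : X -> \bar R) (c : \bar R) :
  measurable D -> measurable A -> D `<=` A -> measurable_fun A g ->
  (forall x, A x -> 0 <= g x) -> 0 <= c -> (forall x, D x -> c <= g x) ->
  c * nu D <= \int[nu]_(x in A) g x.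
Proof.
move=> mD mA DA mg g0 c0 cg; rewrite -integral_cst//.
apply: (@le_trans _ _ (\int[nu]_(x in D) g x)); last exact: ge0_subset_integral.
by apply: ge0_le_integral => //; exact: measurable_funS mg.
Qed.

End series_of_integrals.

(** * Decreasing rearrangements and the top part *)

Section rearrangement_lemmas.
Context {R : realType} {n : nat}.
Local Notation mu := (lebesgue_measure_Rn n).
Implicit Types (h : Rn R n -> \bar R) (f g : Rn R n -> R) (s t : R).

Lemma rearrangement_ge0 h t : 0 <= rearrangement h t.
Proof. by apply: le_ereal_inf_tmp => _ [s [/ltW s0 _] <-]; rewrite lee_fin. Qed.

Lemma rearrangement_nonincreasing h :
  {homo rearrangement h : s t / (s <= t)%R >-> t <= s}.
Proof.
move=> s t st; apply: ereal_inf_le_tmp => _ [y [y0 hy] <-]; exists y => //.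
by split=> //; apply: le_trans hy _; rewrite lee_fin.
Qed.

Lemma measurable_rearrangement h (D : set R) : measurable D ->
  measurable_fun D (rearrangement h).
Proof. move=> mD; apply: nonincreasing_emeasurable => //; exact: rearrangement_nonincreasing. Qed.

Lemma measure_gt_rearrangement h t (c : R) : measurable_fun setT h ->
  rearrangement h t = c%:E -> mu [set x | c%:E < `|h x|] <= t%:E.
Proof.
move=> mh hc; apply: measure_gt_right_continuous => // y cy.
have : rearrangement h t < y%:E by rewrite hc lte_fin.
move=> /ereal_inf_lt[_ [s [s0 hs] <-]]; rewrite lte_fin => sy.
apply: le_trans hs; apply: le_measure; rewrite ?inE.
- exact: measurable_superlevel.
- exact: measurable_superlevel.
- by move=> x /=; apply: lt_trans; rewrite lte_fin.
Qed.

Lemma rearrangement_le h t (L : R) : (0 <= L)%R ->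
  mu [set x | L%:E < `|h x|] <= t%:E -> measurable_fun setT h ->
  rearrangement h t <= L%:E.
Proof.
move=> L0 hL mh; apply/lee_addgt0Pr => e e0; rewrite -EFinD.
apply: ereal_inf_lbound; exists (L + e)%R => //; split; first lra.
apply: le_trans hL; apply: le_measure; rewrite ?inE.
- exact: measurable_superlevel.
- exact: measurable_superlevel.
- by move=> x /=; apply: lt_trans; rewrite lte_fin; lra.
Qed.

Lemma rearrangement_fin_num h t s : (0 < t)%R -> (0 < s)%R ->
  \int[lebesgue_measure]_(r in `]0%R, t[) rearrangement h r < +oo ->
  rearrangement h s \is a fin_num.
Proof.
move=> t0 s0; rewrite ge0_fin_numE ?rearrangement_ge0//; apply: contraTT.
rewrite -!leNgt !leye_eq => /eqP hs; rewrite -leye_eq.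
have m0 : (0 < Num.min s t)%R by rewrite lt_min s0.
apply: (@le_trans _ _ (+oo * lebesgue_measure `]0%R, Num.min s t[%classic)).
  rewrite lebesgue_measure_itv /= lte_fin m0 -EFinB subr0 mulyr gtr0_sg//.
  by rewrite mul1e.
apply: integral_ge_cst => //.
- by move=> x /=; rewrite !in_itv /= lt_min => /andP[-> /andP[]].
- exact: measurable_rearrangement.
- by move=> x _; exact: rearrangement_ge0.
- move=> x /=; rewrite in_itv /= lt_min => /andP[_ /andP[xs _]].
  by rewrite -hs; apply: rearrangement_nonincreasing; exact: ltW.
Qed.

(* Dyadic layer-cake: on [{f*(t 2^-k) < |f| <= f*(t 2^-(k+1))}], a set of
   measure at most [t 2^-k], compare with [f*] on [](t 2^-(k+2), t 2^-(k+1)[]. *)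
Lemma integral_top_layer_le f g t : (0 < t)%R ->
  measurable_fun setT f -> measurable_fun setT g ->
  (forall x, `|g x| <= `|f x|)%R ->
  (forall x, g x != 0%R -> rearrangement (EFin \o f) t < `|f x|%:E) ->
  \int[lebesgue_measure]_(r in `]0%R, t[) rearrangement (EFin \o f) r < +oo ->
  \int[mu]_x `|g x|%:E <=
    4%:E * \int[lebesgue_measure]_(r in `]0%R, t[) rearrangement (EFin \o f) r.
Proof.
move=> t0 mf mg gf g0 Aoo.
pose tk k := (t / 2 ^+ k)%R.
have tk0 k : (0 < tk k)%R by rewrite divr_gt0 ?exprn_gt0.
have tkS k : (tk k = 2 * tk k.+1)%R.
  by rewrite /tk exprS; field; rewrite expf_neq0.
have tk_ni i j : (i <= j)%N -> (tk j <= tk i)%R.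
  move=> ij; rewrite ler_pM2l// lef_pV2 ?posrE ?exprn_gt0//.
  by rewrite ler_weXn2l// ler1n.
have tk_t k : (tk k <= t)%R by have := tk_ni 0%N k (leq0n k); rewrite /tk expr0 divr1.
pose b k := fine (rearrangement (EFin \o f) (tk k)).
have bE k : rearrangement (EFin \o f) (tk k) = (b k)%:E.
  by rewrite fineK// (rearrangement_fin_num t0).
have b0 k : (0 <= b k)%R by rewrite -lee_fin -bE rearrangement_ge0.
pose B k := [set x | (b k)%:E < `|(EFin \o f) x|].
have mf' : measurable_fun setT (EFin \o f) by exact/measurable_EFinP.
have mB k : measurable (B k) by exact: measurable_superlevel.
have muB k : mu (B k) <= (tk k)%:E by exact: measure_gt_rearrangement.
(* Outside the null intersection of the [B k], a point where [g] is nonzero lies in some [B m] but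
   not in [B m.+1], and the term of index [m] alone suffices. *)
have ae_bound : {ae mu, forall x, setT x ->
    `|g x|%:E <= \sum_(k <oo) ((b k.+1)%:E * (\1_(B k) x)%:E)}.
  exists (\bigcap_k B k); split.
  - exact: bigcapT_measurable.
  - apply/eqP; rewrite eq_le measure_ge0 andbT; apply/lee_addgt0Pr => e e0; rewrite add0e.
    have [k ke] : exists k, (tk k < e)%R.
      have [k] := ltr_add_invr (divr_gt0 e0 t0); rewrite add0r => ke.
      exists k; rewrite /tk ltr_pdivrMr ?exprn_gt0// mulrC -ltr_pdivrMr//.
      have -> : (t / e = (e / t)^-1)%R by rewrite invf_div.
      rewrite invf_plt ?posrE ?divr_gt0 ?exprn_gt0//; apply: le_lt_trans ke.
      by rewrite lef_pV2 ?posrE ?exprn_gt0// -natrX ler_nat ltn_expl.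
    apply: (@le_trans _ _ (mu (B k))).
      by apply: le_measure; rewrite ?inE//; [exact: bigcapT_measurable|exact: bigcap_inf].
    by apply: (le_trans (muB k)); rewrite lee_fin ltW.
  - move=> x nP; apply: contrapT => xB; apply: nP => _.
    have sum0 : 0 <= \sum_(k <oo) ((b k.+1)%:E * (\1_(B k) x)%:E).
      by apply: nneseries_ge0 => k _ _; rewrite -EFinM lee_fin mulr_ge0.
    have [gx0|gx0] := eqVneq (g x) 0%R; first by rewrite gx0 normr0.
    have xB0 : B 0%N x.
      have := g0 x gx0; rewrite /B /= -bE /tk expr0 divr1; exact.
    have [k kP] : exists k, ~ B k x.
      by apply: contrapT => h; apply: xB => k _; apply: contrapT => ?; apply: h; exists k.
    have [m [mB1 mB2]] : exists m, B m x /\ ~ B m.+1 x.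
      elim: k kP => [//|k IH] kP; have [Bk|/IH//] := pselect (B k x).
      by exists k.
    apply: (@le_trans _ _ ((b m.+1)%:E * (\1_(B m) x)%:E)).
      rewrite indicE mem_set// mule1; apply: (@le_trans _ _ `|f x|%:E).
        by rewrite lee_fin.
      by move/negP: mB2; rewrite -leNgt.
    rewrite (@nneseriesD1 _ _ m xpredT)//; last first.
      by move=> k' _; rewrite -EFinM lee_fin mulr_ge0.
    rewrite leeDl// nneseries_ge0// => k' _ _.
    by rewrite -EFinM lee_fin mulr_ge0.
apply: (@le_trans _ _ (\int[mu]_x (\sum_(k <oo) ((b k.+1)%:E * (\1_(B k) x)%:E)))).
  apply: ae_ge0_le_integral => //.
  - by apply/measurable_EFinP; exact: measurableT_comp.
  - by move=> x _; apply: nneseries_ge0 => k _ _; rewrite -EFinM lee_fin mulr_ge0.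
  - apply: ge0_emeasurable_sum => [k x _ _|k _].
      by rewrite -EFinM lee_fin mulr_ge0.
    apply: emeasurable_funM => //; apply/measurable_EFinP; exact: measurable_indic.
rewrite integral_nneseries//; first last.
- by move=> k x _; rewrite -EFinM lee_fin mulr_ge0.
- move=> k; apply: emeasurable_funM => //; apply/measurable_EFinP; exact: measurable_indic.
pose D k : set (measurableTypeR R) := `]tk k.+2, tk k.+1[%classic.
have mD k : measurable (D k) by exact: measurable_itv.
have Dt k : D k `<=` `]0%R, t[%classic.
  move=> r; rewrite /D /= !in_itv /= => /andP[r1 r2].
  by rewrite (lt_trans _ r1)// (lt_le_trans r2).
have int0 k : 0 <= \int[lebesgue_measure]_(r in D k) rearrangement (EFin \o f) r.
  by apply: integral_ge0 => r _; exact: rearrangement_ge0.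
apply: (@le_trans _ _ (4%:E * \sum_(k <oo)
    \int[lebesgue_measure]_(r in D k) rearrangement (EFin \o f) r)); last first.
  rewrite lee_wpmul2l ?lee_fin//; apply: nneseries_integral_le => //.
  - move=> i j ij; rewrite -subset0 => r []; rewrite /D /= !in_itv /=.
    move=> /andP[r1 _] /andP[_ r2]; have := tk_ni i.+2 j.+1 ij.
    by move=> r3; have := lt_le_trans (lt_trans r1 r2) r3; rewrite ltxx.
  - exact: measurable_rearrangement.
  - by move=> r _; exact: rearrangement_ge0.
rewrite -nneseriesZl//; apply: lee_nneseries => [k _ _|k _].
  apply: integral_ge0 => x _; by rewrite -EFinM lee_fin mulr_ge0.
have m1 : measurable_fun setT (fun x => ((\1_(B k) x)%:E : \bar R)).
  by apply/measurable_EFinP; exact: measurable_indic.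
rewrite ge0_integralZl_EFin ?b0// integral_indic// setIT.
apply: (@le_trans _ _ ((b k.+1)%:E * (tk k)%:E)); first by apply: lee_wpmul2l; rewrite ?lee_fin ?b0 ?muB.
(* Two halvings separate the measure bound [tk k] from the length [tk k.+2] of [D k]: hence the
   factor 4. *)
apply: (@le_trans _ _ (4%:E * ((b k.+1)%:E * (tk k.+2)%:E))).
  by rewrite -!EFinM lee_fin (tkS k) (tkS k.+1); lra.
rewrite lee_wpmul2l ?lee_fin//.
have -> : (tk k.+2)%:E = lebesgue_measure (D k).
  rewrite lebesgue_measure_itv /= lte_fin ifT; last first.
    by rewrite (tkS k.+1); have := tk0 k.+2; lra.
  by rewrite -EFinB (tkS k.+1); congr EFin; lra.
apply: integral_ge_cst => //.
- exact: (measurable_rearrangement _ (mD k)).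
- by move=> r _; exact: rearrangement_ge0.
- by rewrite lee_fin.
- move=> r; rewrite /D /= in_itv /= => /andP[_ r2]; rewrite -bE.
  by apply: rearrangement_nonincreasing; exact: ltW.
Qed.

End rearrangement_lemmas.

(** * The logarithmic kernel on layers *)

Section log_layers.
Context {R : realType}.

Lemma measurable_inv_ge0 d (X : measurableType d) (D : set X) (g : X -> R) :
  measurable_fun D g -> (forall x, D x -> (0 <= g x)%R) ->
  measurable_fun D (fun x => (g x)^-1)%R.
Proof.
move=> mg g0; apply: (eq_measurable_fun (fun x => g x `^ (-1))%R).
  by move=> x; rewrite inE => /g0 gx0; rewrite powR_inv1.
exact: (measurableT_comp (measurable_powR (-1))).
Qed.

Lemma integral_inv (a b : R) : (0 < a)%R -> (a < b)%R ->
  \int[lebesgue_measure]_(s in `]a, b[) (s^-1)%:E = (ln b - ln a)%:E.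
Proof.
move=> a0 ab; have b0 := lt_trans a0 ab.
have cinv : {within `[a, b], continuous (@GRing.inv R)}.
  apply: continuous_in_subspaceT => x; rewrite inE /= in_itv /= => /andP[ax _].
  by apply: inv_continuous; rewrite gt_eqF// (lt_le_trans a0).
rewrite -(@integral_itv_bndoo R a b _ true false); last first.
  apply/measurable_EFinP; apply: subspace_continuous_measurable_fun => //.
  apply: continuous_in_subspaceT => x; rewrite inE /= in_itv /= => /andP[ax _].
  by apply: inv_continuous; rewrite gt_eqF// (lt_trans a0).
rewrite (@continuous_FTC2 _ _ (@ln R)) ?EFinB//.
  split.
  - move=> x; rewrite in_itv /= => /andP[ax _]; apply: ex_derive.
    by apply: is_derive1_ln; exact: lt_trans ax.
  - by apply: cvg_at_right_filter; exact: continuous_ln.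
  - by apply: cvg_at_left_filter; exact: continuous_ln.
move=> x; rewrite in_itv /= => /andP[ax _]; rewrite derive1E.
by apply: derive_val; apply: is_derive1_ln; exact: lt_trans ax.
Qed.

Variables (phi : R -> R) (t : R).
Hypotheses (phiA : admissible phi) (t0 : (0 < t)%R).

Definition log_weight (s : R) : R := ((1 + ln (s / t))^-1 * phi (1 + ln (s / t)) / s)%R.

Let ln_ge s : (t < s)%R -> (0 <= ln (s / t))%R.
Proof. by move=> ts; rewrite ln_ge0// ler_pdivlMr// mul1r ltW. Qed.

Let phi1 x : (1 <= x)%R -> (1 <= phi x)%R.
Proof. by case: phiA => + _ _ _; apply. Qed.

Lemma log_weight_ge0 s : (t < s)%R -> (0 <= log_weight s)%R.
Proof.
move=> ts; have s0 := lt_trans t0 ts; have l0 := ln_ge ts.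
rewrite /log_weight divr_ge0 ?(ltW s0)// mulr_ge0// ?invr_ge0 ?addr_ge0//.
by rewrite (le_trans _ (phi1 _))// lerDl.
Qed.

Lemma measurable_log_weight : measurable_fun `]t, +oo[%classic log_weight.
Proof.
(* Nothing is known of [phi] below 1; freezing it there gives a function monotone on the whole
   line. *)
pose psi (x : R) := phi (Num.max 1%R x).
have mpsi : measurable_fun setT psi.
  apply: nondecreasing_measurable => // x y xy.
  rewrite /psi; apply: (admissible_nondecreasing phiA).
    by rewrite le_max lexx.
  by rewrite ge_max !le_max lexx /= xy orbT.
have mln : measurable_fun setT (fun s : R => 1 + ln (s / t))%R.
  apply: measurable_funD => //; apply: measurableT_comp => //.
  exact: measurable_funM.
apply: (eq_measurable_fun
  (fun s : R => (1 + ln (s / t))^-1 * psi (1 + ln (s / t)) / s)%R).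
  move=> s; rewrite inE /= in_itv /= andbT => /ln_ge l0.
  by rewrite /log_weight /psi max_r// lerDl.
apply: measurable_funM; last first.
  apply: measurable_inv_ge0 => // s; rewrite /= in_itv /= andbT => ts.
  by rewrite ltW// (lt_trans t0).
apply: measurable_funM; last by apply: measurable_funTS; exact: measurableT_comp.
apply: measurable_inv_ge0; first exact: measurable_funTS.
by move=> s; rewrite /= in_itv /= andbT => /ln_ge l0; rewrite addr_ge0.
Qed.

(* Cut points at which [1 + ln (s / t)] doubles *)
Definition cut_point (j : nat) : R := (t * expR (2 ^+ j - 1))%R.

Lemma cut_point0 : cut_point 0 = t.
Proof. by rewrite /cut_point expr0 subrr expR0 mulr1. Qed.

Lemma cut_point_gt0 j : (0 < cut_point j)%R.
Proof. by rewrite mulr_gt0 ?expR_gt0. Qed.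

Lemma cut_point_lt i j : (i < j)%N -> (cut_point i < cut_point j)%R.
Proof. by move=> ij; rewrite ltr_pM2l// ltr_expR ltrD2r ltr_eXn2l// ltr1n. Qed.

Lemma cut_point_le i j : (i <= j)%N -> (cut_point i <= cut_point j)%R.
Proof. by move=> ij; rewrite ler_pM2l// ler_expR lerD2r ler_eXn2l// ltr1n. Qed.

(** On the layer [1 + ln (s / t)] lies between [2 ^+ i] and [2 ^+ i.+1], while ds/s has total mass
    [2 ^+ i]; the quotient leaves the factor 1/2. *)
Lemma integral_log_layer_ge (h : R -> \bar R) (c : R) i :
  (0 <= c)%R -> measurable_fun `]cut_point i, cut_point i.+1[%classic h ->
  (forall s, `]cut_point i, cut_point i.+1[%classic s -> c%:E <= h s) ->
  (c * phi (2 ^+ i) / 2)%:E <=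
  \int[lebesgue_measure]_(s in `]cut_point i, cut_point i.+1[) ((log_weight s)%:E * h s).
Proof.
move=> c0 mh ch; set D := `]_, _[%classic in mh ch *.
have mD : measurable (D : set (measurableTypeR R)) by exact: measurable_itv.
have Dt s : D s -> (t < s)%R.
  rewrite /D /= in_itv /= => /andP[si _]; apply: le_lt_trans si.
  by rewrite -{1}cut_point0 cut_point_le.
have p0 : (0 < 2 ^+ i :> R)%R by rewrite exprn_gt0.
have p1 : (1 <= 2 ^+ i :> R)%R by rewrite exprn_ege1// ler1n.
pose k : R := (c * phi (2 ^+ i) / 2 ^+ i.+1)%R.
have k0 : (0 <= k)%R.
  by rewrite divr_ge0 ?exprn_ge0// mulr_ge0// (le_trans _ (phi1 p1)).
have minv : measurable_fun D (fun s => (s^-1)%:E : \bar R).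
  apply/measurable_EFinP; apply: measurable_inv_ge0 => // s /Dt ts.
  by rewrite ltW// (lt_trans t0).
apply: (@le_trans _ _ (\int[lebesgue_measure]_(s in D) (k%:E * (s^-1)%:E))).
  rewrite ge0_integralZl_EFin//; last first.
    by move=> s /Dt ts; rewrite lee_fin invr_ge0 ltW// (lt_trans t0).
  rewrite integral_inv ?cut_point_gt0 ?cut_point_lt// -EFinM lee_fin.
  rewrite !lnM ?posrE ?expR_gt0// !expRK /k exprS.
  set q := (2 ^+ i)%R in p0 *.
  rewrite le_eqVlt; apply/orP; left; apply/eqP; field.
  by rewrite gt_eqF.
apply: ge0_le_integral => //.
- by move=> s /Dt ts; rewrite -EFinM lee_fin mulr_ge0// invr_ge0 ltW// (lt_trans t0).
- exact: emeasurable_funM.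
- apply: emeasurable_funM => //; apply/measurable_EFinP.
  apply: measurable_funS measurable_log_weight => // s /Dt ts.
  by rewrite /= in_itv /= ts.
- move=> s Ds; have ts := Dt _ Ds; have s0 := lt_trans t0 ts; have l0 := ln_ge ts.
  apply: (@le_trans _ _ ((log_weight s)%:E * c%:E)); last first.
    by rewrite lee_wpmul2l ?lee_fin ?log_weight_ge0 ?ch.
  rewrite -!EFinM lee_fin /k /log_weight.
  have [l1 l2] : (2 ^+ i <= 1 + ln (s / t))%R /\ (1 + ln (s / t) <= 2 ^+ i.+1)%R.
    move: Ds; rewrite /D /= in_itv /= /cut_point => /andP[s1 s2].
    have st0 : (0 < s / t)%R by rewrite divr_gt0.
    have e1 : (expR (2 ^+ i - 1) <= s / t)%R by rewrite ler_pdivlMr// mulrC ltW.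
    have e2 : (s / t <= expR (2 ^+ i.+1 - 1))%R by rewrite ler_pdivrMr// mulrC ltW.
    split.
      have : (2 ^+ i - 1 <= ln (s / t))%R.
        by rewrite -[leLHS]expRK ler_ln ?posrE ?expR_gt0.
      lra.
    have : (ln (s / t) <= 2 ^+ i.+1 - 1)%R.
      by rewrite -[leRHS]expRK ler_ln ?posrE ?expR_gt0.
    lra.
  have key : (phi (2 ^+ i) / 2 ^+ i.+1 <= (1 + ln (s / t))^-1 * phi (1 + ln (s / t)))%R.
    rewrite mulrC; apply: ler_pM; rewrite ?invr_ge0 ?exprn_ge0//.
    + by rewrite (le_trans _ (phi1 p1)).
    + by rewrite lef_pV2 ?posrE ?exprn_gt0// (lt_le_trans p0).
    + exact: admissible_nondecreasing.
  rewrite [leLHS](_ : _ = phi (2 ^+ i) / 2 ^+ i.+1 * (c / s))%R; last by ring.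
  rewrite [leRHS](_ : _ = (1 + ln (s / t))^-1 * phi (1 + ln (s / t)) * (c / s))%R; last by ring.
  by rewrite ler_wpM2r// divr_ge0// ltW.
Qed.

End log_layers.

(** * Adding levels and exceptional sets *)

Section union_bound.
Context d (X : measurableType d) (R : realType) (nu : {measure set X -> \bar R}).

(** Off the null set and off every set where some [hk k] exceeds its own level, the series is at
    most [L]. Levels and measures add separately, so no quasi-norm constant accumulates. *)
Lemma measure_gt_nneseries (h : X -> \bar R) (hk : nat -> X -> \bar R)
    (lam : nat -> R) (tau : nat -> \bar R) (L : R) :
  measurable_fun setT h -> (forall k, measurable_fun setT (hk k)) ->
  {ae nu, forall x, `|h x| <= \sum_(k <oo) `|hk k x|} ->
  (forall k, (0 <= lam k)%R) -> \sum_(k <oo) (lam k)%:E <= L%:E ->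
  (forall k, nu [set x | (lam k)%:E < `|hk k x|] <= tau k) ->
  nu [set x | L%:E < `|h x|] <= \sum_(k <oo) tau k.
Proof.
move=> mh mhk [Z [mZ Z0 hZ]] lam0 lamL htau.
pose B k := [set x | (lam k)%:E < `|hk k x|].
have mB k : measurable (B k) by exact: measurable_superlevel.
apply: (@le_trans _ _ (nu (Z `|` \bigcup_k B k))).
  apply: le_measure; rewrite ?inE.
  - exact: measurable_superlevel.
  - by apply: measurableU => //; exact: bigcup_measurable.
  - move=> x Lx; have [xZ|xZ] := pselect (Z x); [by left|right].
    apply: contrapT => nB; apply: xZ; apply: hZ => /= hx.
    have : `|h x| <= L%:E.
      apply: (le_trans hx); apply: le_trans lamL.
      apply: lee_nneseries => [k _ _|k _]; first exact: abse_ge0.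
      by rewrite leNgt; apply/negP => Bk; apply: nB; exists k.
    by rewrite leNgt Lx.
have mUB : measurable (\bigcup_k B k) by exact: bigcup_measurable.
apply: (le_trans (measureU2 nu mZ mUB)); rewrite [X in X + _]Z0 add0e.
apply: le_trans (measure_sigma_subadditive nu mB mUB (@subset_refl _ _)) _.
by apply: lee_nneseries => [k _ _|k _]; [exact: measure_ge0|exact: htau].
Qed.

End union_bound.

Section weak_type.
Context {R : realType} {n : nat}.
Local Notation mu := (lebesgue_measure_Rn n).

Lemma weak11_level (h : Rn R n -> \bar R) (K I t : R) : measurable_fun setT h ->
  (0 < K)%R -> (0 <= I)%R -> (0 < t)%R ->
  lorentz_pinfty mu 1 h <= (K * I)%:E ->
  mu [set x | (2 * K * I / t)%:E < `|h x|] <= (t / 2)%:E.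
Proof.
move=> mh K0 I0 t0 hK; apply: measure_gt_right_continuous => // y yI.
have y0 : (0 < y)%R.
  by apply: le_lt_trans yI; rewrite divr_ge0 ?mulr_ge0 ?(ltW K0) ?(ltW t0).
have : y%:E * mu [set x | y%:E < `|h x|] <= (K * I)%:E.
  apply: le_trans hK; apply: ereal_sup_ubound; exists y => //.
  by rewrite invr1 poweRe1// measure_ge0.
rewrite muleC -lee_pdivlMr// => /le_trans; apply.
rewrite -EFinM lee_fin ler_pdivrMr//.
by move: yI; rewrite ltr_pdivrMr//; lra.
Qed.

End weak_type.

(** The crude bound e <= 4 suffices; it follows by squaring exp(-1/2) >= 1/2. *)
Lemma expR_le_pow2 (R : realType) (q : nat) : (expR q%:R <= 2 ^+ (2 * q) :> R)%R.
Proof.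
have e2 : (expR 1 <= 4 :> R)%R.
  have h : (2^-1 <= expR (- 2^-1) :> R)%R.
    by apply: le_trans (expR_ge1Dx _); lra.
  have e0 : (0 < expR (- 2^-1) :> R)%R by exact: expR_gt0.
  rewrite [X in expR X](_ : 1 = - (- 2^-1 + - 2^-1) :> R)%R; last by lra.
  rewrite expRN expRD; set x := expR _ in h e0 *.
  rewrite invf_ple ?posrE ?mulr_gt0// (_ : 4^-1 = 2^-1 * 2^-1 :> R)%R; last by field.
  by rewrite ler_pM.
rewrite -[q%:R%R]mulr1 expRM_natl exprM -[(2 ^+ 2)%R]/(2 * 2)%R.
by rewrite lerXn2r ?nnegrE ?expR_ge0//; lra.
Qed.

(** The size hypothesis of [layer_estimate] for [N = 2 ^ j.+3] and [tau = t / 2 ^ j.+2]. Half of the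
    exponent absorbs the exponential growth of the cut point, the other half the small [tau]. *)
Lemma cut_point_succ_le (R : realType) (t : R) (j : nat) : (0 < t)%R ->
  (cut_point t j.+1 <= 2 ^+ (2 ^ j.+3) * (t / (2 ^ j.+2)%:R))%R.
Proof.
move=> t0; rewrite /cut_point mulrCA ler_pM2l// ler_pdivlMr; last first.
  by rewrite ltr0n expn_gt0.
have le1 : (expR (2 ^+ j.+1 - 1) <= 2 ^+ (2 * 2 ^ j.+1) :> R)%R.
  apply: le_trans (expR_le_pow2 _ _).
  by rewrite ler_expR natrX gerBl.
have le2 : ((2 ^ j.+2)%:R <= 2 ^+ (2 * 2 ^ j.+1) :> R)%R.
  rewrite natrX ler_weXn2l ?ler1n//.
  by rewrite -expnS; exact: ltnW (ltn_expl _ _).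
apply: le_trans (ler_pM _ _ le1 le2) _; rewrite ?expR_ge0//.
by rewrite -exprD -mulnDl -[(2 + 2)%N]/(2 * 2)%N -mulnA -!expnS.
Qed.

(** * Assembly of the rearrangement inequality *)

Theorem theorem1p8 (R : realType) (n : nat) (n_gt0 : (0 < n)%N)
  (T : (Rn R n -> R) -> Rn R n -> \bar R) (T_sublinear : sublinear T)
  (T_weak11 : exists2 K : R, (0 < K)%R &
    forall f : Rn R n -> R, measurable_fun [set: Rn R n] f ->
      lorentz_pinfty (lebesgue_measure_Rn n) 1%R (T f) <=
      K%:E * 'N[lebesgue_measure_Rn n]_1[EFin \o f])
  (p0 C : R) (phi : R -> R) (p0_gt1 : (1 < p0)%R) (C_gt0 : (0 < C)%R)
  (phi_admissible : admissible phi)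
  (T_weighted : forall u : Rn R n -> R, Ap p0 u ->
    forall f : Rn R n -> R, measurable_fun [set: Rn R n] f ->
      lorentz_pinfty (wmeasure u) p0 (T f) <=
      (C * phi (fine (Ap_norm p0 u)))%:E *
        lorentz_p1 (wmeasure u) p0 (EFin \o f)) :
  exists2 C' : R, (0 < C')%R &
    forall (t : R) (f : Rn R n -> R), (0 < t)%R ->
      measurable_fun [set: Rn R n] f -> countably_subadditive_at T f ->
      rearrangement (T f) t <=
      C'%:E *
        ((t^-1)%:E * \int[lebesgue_measure]_(s in `]0%R, t[)
             rearrangement (EFin \o f) s +
         \int[lebesgue_measure]_(s in `]t, +oo[)
           (((1 + ln (s / t))^-1 * phi (1 + ln (s / t)) / s)%:E *
            rearrangement (EFin \o f) s)).
Proof.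
have [K K0 TK] := T_weak11; have [mT _ _] := T_sublinear.
have [B B0 phiB] := admissible_scale phi_admissible.
have phi_ge1 x : (1 <= x)%R -> (1 <= phi x)%R by case: phi_admissible => + _ _ _; apply.
have phi11 : phi 1%R = 1%R by case: phi_admissible.
set A1 := @A1_const R n.
have A1_ge1 : (1 <= A1)%R.
  by rewrite /A1 /A1_const -addrA addrCA lerDl addr_ge0// mulr_ge0// exprn_ge0.
(* For the layer [j = i.+1], where [N = 2 ^ j.+3], the argument of [phi] is [16 * A1 * 2 ^+ i]; the
   exponential is the price, uniform in [i], of returning to [phi (2 ^+ i)]. *)
pose c0 : R := (C * (2 + 3 ^+ n) * expR (B * (16 * A1 - 1)))%R.
have c00 : (0 < c0)%R by rewrite !mulr_gt0 ?expR_gt0// addr_gt0 ?exprn_gt0.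
(* [8 * K] combines the 2 of [weak11_level] with the 4 of the top layer; the 2 before [c0] undoes
   the half in [integral_log_layer_ge]. *)
exists (8 * K + 2 * c0)%R; first lra.
move=> t f t0 mf csa.
set fs := rearrangement (EFin \o f).
set I1 := \int[lebesgue_measure]_(s in `]0%R, t[) _.
set I2 := \int[lebesgue_measure]_(s in `]t, +oo[) _.
have mef : measurable_fun setT (EFin \o f) by exact/measurable_EFinP.
have fs0 s : 0 <= fs s by exact: rearrangement_ge0.
have I10 : 0 <= I1 by apply: integral_ge0 => s _; exact: fs0.
have W0 s : (t < s)%R -> 0 <= (log_weight phi t s)%:E * fs s.
  by move=> ts; rewrite mule_ge0// lee_fin log_weight_ge0.
have I20 : 0 <= I2.
  by apply: integral_ge0 => s /=; rewrite in_itv /= andbT; exact: W0.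
have [I1oo|I1noo] := eqVneq I1 +oo.
  rewrite I1oo mulry gtr0_sg ?invr_gt0// mul1e addye ?gt_eqF ?(lt_le_trans _ I20)//.
  by rewrite mulry gtr0_sg ?mul1e ?leey//; lra.
have [I2oo|I2noo] := eqVneq I2 +oo.
  rewrite I2oo addey; last first.
    by rewrite gt_eqF// (@lt_le_trans _ _ 0)// mule_ge0// lee_fin invr_ge0 ltW.
  by rewrite mulry gtr0_sg ?mul1e ?leey//; lra.
have I1fin : I1 \is a fin_num by rewrite ge0_fin_numE// ltey.
have I2fin : I2 \is a fin_num by rewrite ge0_fin_numE// ltey.
pose i1 := fine I1; pose i2 := fine I2.
have i1E : I1 = i1%:E by rewrite fineK.
have i2E : I2 = i2%:E by rewrite fineK.
have i10 : (0 <= i1)%R by rewrite -lee_fin -i1E.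
have i20 : (0 <= i2)%R by rewrite -lee_fin -i2E.
pose a j := fine (fs (cut_point t j)).
have aE j : fs (cut_point t j) = (a j)%:E.
  by rewrite fineK// (rearrangement_fin_num t0) ?cut_point_gt0// -/fs -/I1 i1E ltry.
have a0 j : (0 <= a j)%R by rewrite -lee_fin -aE fs0.
pose P j := [set x | (a j)%:E < `|(EFin \o f) x|].
have mP j : measurable (P j) by exact: measurable_superlevel.
have muP j : lebesgue_measure_Rn n (P j) <= (cut_point t j)%:E by exact: measure_gt_rearrangement.
pose E j := P j.+1 `\` P j.
have mE j : measurable (E j) by exact: measurableD.
have PS i j : (i <= j)%N -> P i `<=` P j.
  move=> ij x; rewrite /P /=; apply: le_lt_trans; rewrite -!aE.
  by apply: rearrangement_nonincreasing; exact: cut_point_le.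
(* [A 0] joins the top part [P 0] to the points lying in no [P j], where [f] will be shown to
   vanish. *)
pose A k := if k is j.+1 then E j else ~` \bigcup_j E j.
have mA k : measurable (A k).
  by case: k => [|j]; [apply: measurableC; exact: bigcup_measurable|exact: mE].
have tA : trivIset setT A.
  apply: trivIset_lt => -[|i] [|j]// ij; rewrite -subset0 => x [].
    by move=> nE Ex; apply: nE; exists j.
  move=> [Pi _] [_ nPj]; apply: nPj; exact: PS Pi.
have UA : \bigcup_k A k = setT.
  apply/seteqP; split => // x _; have [[j _ Ej]|nE] := pselect ((\bigcup_j E j) x).
    by exists j.+1.
  by exists 0%N.
pose J i := \int[lebesgue_measure]_(s in `]cut_point t i, cut_point t i.+1[)
  ((log_weight phi t s)%:E * fs s).
have Jge i : (a i.+1 * phi (2 ^+ i) / 2)%:E <= J i.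
  apply: integral_log_layer_ge => //.
    by apply: measurable_rearrangement; exact: measurable_itv.
  move=> s /=; rewrite in_itv /= => /andP[_ si]; rewrite -aE.
  by apply: rearrangement_nonincreasing; exact: ltW.
have J0 i : 0 <= J i.
  apply: le_trans (Jge i); rewrite lee_fin divr_ge0// mulr_ge0//.
  by rewrite (le_trans _ (phi_ge1 _ _))// exprn_ege1// ler1n.
have JI2 : \sum_(i <oo) J i <= I2.
  apply: nneseries_integral_le.
  - by move=> k; exact: measurable_itv.
  - move=> i j ij; rewrite -subset0 => r []; rewrite /= !in_itv /=.
    move=> /andP[_ r1] /andP[r2 _]; have := cut_point_le t0 ij.
    by move=> r3; have := lt_le_trans (lt_trans r2 r1) r3; rewrite ltxx.
  - exact: measurable_itv.
  - move=> k s; rewrite /= !in_itv /= andbT => /andP[s1 _]; apply: le_lt_trans s1.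
    by rewrite -{1}(cut_point0 t) cut_point_le.
  - apply: emeasurable_funM.
      by apply/measurable_EFinP; exact: measurable_log_weight.
    by apply: measurable_rearrangement; exact: measurable_itv.
  - by move=> s; rewrite /= in_itv /= andbT; exact: W0.
(* A nonzero value below all [a j] would make every [J i] at least [|f x| / 2], since [phi >= 1],
   against the finiteness of [I2]. *)
have A0P x : A 0%N x -> ~ P 0%N x -> f x = 0%R.
  move=> A0x nP0; have nP j : ~ P j x.
    elim: j => [|j nPj Pj1]; first exact: nP0.
    by apply: A0x; exists j.
  apply: contrapT => /eqP fx0; have al0 : (0 < `|f x|)%R by rewrite normr_gt0.
  have al i : ((`|f x| / 2)%:E <= J i).
    apply: le_trans (Jge i); rewrite lee_fin ler_pM2r// -[leLHS]mulr1.
    rewrite ler_pM//; last by rewrite phi_ge1// exprn_ege1// ler1n.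
    by rewrite -lee_fin leNgt; apply/negP => /nP.
  have sm m : ((`|f x| / 2) *+ m <= i2)%R.
    rewrite -lee_fin -i2E; apply: le_trans JI2.
    apply: (@le_trans _ _ (\sum_(0 <= i < m) J i)); last first.
      by apply: nneseries_lim_ge => k _ _; exact: J0.
    rewrite -[m in leLHS]subn0 -sumr_const_nat -sumEFin.
    by apply: lee_sum => k _; exact: al.
  have := truncnS_gt (i2 / `|f x|)%R; set m := (Num.truncn _).+1 => mP'.
  have := sm (2 * m)%N; rewrite -mulr_natr natrM leNgt; apply/negP/negPn.
  by move: mP'; rewrite ltr_pdivrMr//; lra.
pose g k : Rn R n -> R := (f \* \1_(A k))%R.
have mg k : measurable_fun setT (g k).
  by apply: measurable_funM => //; exact: measurable_indic.
have gle k x : (`|g k x| <= `|f x|)%R.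
  by rewrite /g /= normrM indicE; case: (x \in A k); rewrite ?normr1 ?mulr1// normr0 mulr0.
have goff k x : ~ A k x -> g k x = 0%R.
  by move=> nA; rewrite /g /= indicE memNset// mulr0.
have gon k x : g k x != 0%R -> A k x.
  by move=> gx; apply: contrapT => /goff/eqP; exact/negP.
pose lam k : R := if k is j.+1 then
    (C * (2 + 3 ^+ n) * phi (A1 * (2 ^ j.+3)%:R) * a j)%R
  else (2 * K * (4 * i1) / t)%R.
have A1_ge j : (1 <= A1 * (2 ^ j)%:R)%R.
  by apply: mulr_ege1 => //; rewrite ler1n expn_gt0.
have lam0 k : (0 <= lam k)%R.
  case: k => [|j] /=.
    by rewrite divr_ge0 ?(ltW t0)// !mulr_ge0 ?(ltW K0).
  rewrite !mulr_ge0 ?(ltW C_gt0) ?addr_ge0 ?exprn_ge0//.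
  by rewrite (le_trans _ (phi_ge1 _ (A1_ge _))).
have level k : lebesgue_measure_Rn n [set x | (lam k)%:E < `|T (g k) x|] <= (t / (2 ^ k.+1)%:R)%:E.
  case: k => [|j].
    apply: weak11_level => //; [exact: mT|by rewrite mulr_ge0|].
    apply: (le_trans (TK _ (mg 0%N))); rewrite EFinM lee_pmul2l ?lte_fin//.
    rewrite Lnorm1 EFinM -i1E; apply: (integral_top_layer_le t0 mf (mg 0%N) (gle 0%N)).
      move=> x gx; have A0x := gon _ _ gx; apply: contrapT => nP.
      move/eqP: gx; apply; rewrite /g /= (A0P x A0x) ?mul0r//.
      by move=> Px; apply: nP; move: Px; rewrite /P /= -aE cut_point0.
    by rewrite -/fs -/I1 i1E ltry.
  apply: (layer_estimate mT p0_gt1 C_gt0 phi_admissible T_weighted (E := E j)) => //.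
  - by rewrite divr_gt0// ltr0n expn_gt0.
  - by rewrite expn_gt0.
  - move=> x; have [Ex|nE] := pselect (A j.+1 x); last by rewrite (goff j.+1 x nE) normr0.
    apply: (le_trans (gle _ _)); rewrite -lee_fin leNgt; apply/negP => Px.
    by move: Ex => [_ nPx]; exact: nPx Px.
  - by move=> x nE; exact: (goff j.+1).
  - apply: (@le_trans _ _ (cut_point t j.+1)%:E).
      apply: le_trans (muP j.+1); apply: le_measure; rewrite ?inE//.
      exact: subDsetl.
    by rewrite lee_fin cut_point_succ_le.
(* No log layer precedes the cut point [t], so the value of the rearrangement there is charged to
   its mean over ]0, t[. *)
have a0_le : (a 0%N <= i1 / t)%R.
  rewrite ler_pdivlMr// -lee_fin -i1E EFinM.
  have -> : t%:E = lebesgue_measure (`]0%R, t[%classic : set R).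
    by rewrite lebesgue_measure_itv /= lte_fin t0 -EFinB subr0.
  apply: integral_ge_cst => //.
  - exact: measurable_rearrangement.
  - by rewrite lee_fin.
  - move=> s /=; rewrite in_itv /= => /andP[_ st]; rewrite -aE cut_point0.
    by apply: rearrangement_nonincreasing; exact: ltW.
have lam1 : (lam 1%N <= c0 * (i1 / t))%R.
  rewrite /lam; apply: ler_pM => //.
    rewrite !mulr_ge0 ?(ltW C_gt0) ?addr_ge0 ?exprn_ge0//.
    by rewrite (le_trans _ (phi_ge1 _ (A1_ge _))).
  rewrite ler_pM2l ?mulr_gt0 ?addr_gt0 ?exprn_gt0//.
  have := phiB (16 * A1)%R 1%R; rewrite mulr1 phi11 mulr1 lexx => h.
  have le16 : (1 <= 16 * A1)%R by lra.
  apply: le_trans _ (h le16 isT).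
  have le8 : (A1 * (2 ^ 3)%:R <= 16 * A1)%R by rewrite -[(2 ^ 3)%N]/8%N; lra.
  exact: admissible_nondecreasing phi_admissible (A1_ge 3%N) le8.
(* [lam i.+2] carries [a i.+1], which bounds the rearrangement from below on the interval ending at
   [cut_point t i.+1], that of [J i]. *)
have lamS i : (lam i.+2)%:E <= (2 * c0)%:E * J i.
  apply: (@le_trans _ _ ((2 * c0)%:E * (a i.+1 * phi (2 ^+ i) / 2)%:E)); last first.
    by rewrite lee_wpmul2l// lee_fin; lra.
  rewrite -EFinM lee_fin /lam.
  have p1 : (1 <= 2 ^+ i :> R)%R by rewrite exprn_ege1// ler1n.
  have := phiB (16 * A1)%R (2 ^+ i)%R; rewrite p1 => h.
  have {}h : (phi (A1 * (2 ^ i.+4)%:R) <= expR (B * (16 * A1 - 1)) * phi (2 ^+ i))%R.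
    rewrite (_ : A1 * (2 ^ i.+4)%:R = 16 * A1 * 2 ^+ i)%R; first by apply: h => //; lra.
    by rewrite natrX !exprS; ring.
  rewrite (_ : 2 * c0 * _ = C * (2 + 3 ^+ n) *
    (expR (B * (16 * A1 - 1)) * phi (2 ^+ i)) * a i.+1)%R; last by rewrite /c0; field.
  by rewrite ler_wpM2r// ler_wpM2l// mulr_ge0 ?(ltW C_gt0)// addr_ge0// exprn_ge0.
pose L : R := ((8 * K + 2 * c0) * (t^-1 * i1 + i2))%R.
have sumlam : \sum_(k <oo) (lam k)%:E <= L%:E.
  have lamE0 k : 0 <= (lam k)%:E by rewrite lee_fin.
  rewrite (nneseries_split 0%N 2)//.
  rewrite add0n !big_nat_recl// big_nil addr0.
  apply: (@le_trans _ _ ((lam 0%N)%:E + (lam 1%N)%:E + (2 * c0 * i2)%:E)).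
    apply: leeD.
      by rewrite ?adde0.
    apply: (@le_trans _ _ (\sum_(i <oo) (lam i.+2)%:E)).
      rewrite -nneseries_addn//; apply: lee_nneseries => [i _ _|i _]; first exact: lamE0.
      by rewrite addn2.
    apply: (@le_trans _ _ (\sum_(i <oo) ((2 * c0)%:E * J i))).
      by apply: lee_nneseries.
    rewrite nneseriesZl// [leRHS]EFinM -i2E lee_wpmul2l// lee_fin; lra.
  rewrite -!EFinD lee_fin /L.
  have -> : (lam 0%N = 8 * K * (t^-1 * i1))%R by rewrite /lam; field; rewrite gt_eqF.
  have : (lam 1%N <= c0 * (t^-1 * i1))%R by rewrite (mulrC (t^-1)%R).
  have : (0 <= t^-1 * i1)%R by rewrite mulr_ge0// invr_ge0 ltW.
  by set z := (t^-1 * i1)%R => z0 lz; nra.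
have L0 : (0 <= L)%R.
  apply: mulr_ge0; first lra.
  by rewrite addr_ge0 ?mulr_ge0 ?invr_ge0 ?(ltW t0).
rewrite i1E i2E -[leRHS]/(L%:E).
apply: rearrangement_le => //; last exact: mT.
apply: (@le_trans _ _ (\sum_(k <oo) (t / (2 ^ k.+1)%:R)%:E)); last first.
  by apply: epsilon_trick0; exact: ltW.
apply: (measure_gt_nneseries (hk := fun k => T (g k)) (lam := lam)) => //.
- exact: mT.
- by move=> k; exact: mT.
- exact: csa.
Qed.
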